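(* Let $\mu$ be an infinitely divisible distribution on $\mathbb{R}$ with Lévy measure $\nu$, $0<\nu(\mathbb{R})\le\infty$, and let $(\lambda,\nu_\xi)$ be a polar decomposition of $\nu$, i.e. $\nu(B)=\int_{\{-1,1\}}\lambda(d\xi)\int_0^\infty 1_B(r\xi)\,\nu_\xi(dr)$; write $\nu^{+}=\nu_{1}$ and $\nu^{-}=\nu_{-1}$. Let $(M_d)_{d\ge 1}$ be a random matrix model for $\Lambda(\mu)$, where for each $d\ge 1$, $M_d$ is a random $d\times d$ Hermitian matrix with Fourier transform $$\mathbb{E}\left[\exp\left(i\,\mathrm{tr}(M_dA)\right)\right]=\exp\left[d\,\mathbb{E}_u\,\mathcal{C}_\mu\left(\langle u,Au\rangle\right)\right],\qquad A\in\mathbb{M}_d .$$ Then, for each $d\ge 1$, the Lévy measure $\nu_{M_d}$ of $M_d$ is $$\nu_{M_d}(B)=d\int_{\widetilde{\mathbb{S}}_{\mathbb{M}_d}}\int_0^\infty 1_B(rV)\,\nu_V(dr)\,\Pi(dV),\qquad B\in\mathcal{B}(\mathbb{M}_d\setminus\{0\}),$$ where $\nu_V=\nu^{+}$ if $V>0$ and $\nu_V=\nu^{-}$ if $V<0$, and $\Pi$ is a measure on $\widetilde{\mathbb{S}}_{\mathbb{M}_d}$ such that $$\int_{\widetilde{\mathbb{S}}_{\mathbb{M}_d}}1_D(V)\,\Pi(dV)=\int_{\widetilde{\mathbb{S}}^{+}_{\mathbb{M}_d}}\int_{\{-1,1\}}1_D(\xi V)\,\lambda(d\xi)\,\omega_d(dV),\qquad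 D\in\mathcal{B}(\widetilde{\mathbb{S}}_{\mathbb{M}_d}).$$
   Context: Matrices. $\mathbb{M}_d$ is the real linear space of $d\times d$ complex Hermitian matrices with scalar product $\langle A,B\rangle=\mathrm{tr}(AB^* )$ and norm $\|A\|=[\mathrm{tr}(AA^* )]^{1/2}$. $\widetilde{\mathbb{S}}_{\mathbb{M}_d}=\{V\in\mathbb{M}_d:\mathrm{rank}(V)=1,\ \|V\|=1\}$ and $\widetilde{\mathbb{S}}^{+}_{\mathbb{M}_d}=\{V\in\mathbb{M}_d: V>0,\ \mathrm{rank}(V)=1,\ \|V\|=1\}$. For a rank one Hermitian $V$, ''$V>0$'' means that $V$ is positive semidefinite (its unique nonzero eigenvalue is positive) and ''$V<0$'' means $-V>0$; every $V\in\widetilde{\mathbb{S}}_{\mathbb{M}_d}$ satisfies exactly one of the two. The vector $u$ and the measure $\omega_d$. $u$ is a random column vector uniformly distributed on the unit sphere of $\mathbb{C}^d$, $\mathbb{E}_u$ is expectation with respect to $u$, and $\langle u,Au\rangle=u^*Au$ is the usual Hermitian product of $\mathbb{C}^d$ (a real number for $A$ Hermitian). $\omega_d$ is the probability measure on $\widetilde{\mathbb{S}}^{+}_{\mathbb{M}_d}$ that is the law of $V=uu^*$. Cumulant transform. For $\mu$ infinitely divisible on $\mathbb{R}$, $\mathcal{C}_\mu$ is the unique continuous function $\mathbb{R}\to\mathbb{C}$ with $\mathcal{C}_\mu(0)=0$ and $\widehat{\mu}(z)=\int e^{izx}\mu(dx)=\exp(\mathcal{C}_\mu(z))$ for all $z\in\mathbb{R}$.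 The Lévy measure of a random Hermitian matrix with infinitely divisible law is the Lévy measure in its Lévy–Khintchine representation on the Euclidean space $\mathbb{M}_d$. Polar decomposition. The Lévy measure $\nu$ of an infinitely divisible distribution on $\mathbb{R}$ with $0<\nu(\mathbb{R})\le\infty$ can be expressed as $\nu(B)=\int_{\{-1,1\}}\lambda(d\xi)\int_0^\infty 1_B(r\xi)\,\nu_\xi(dr)$, where $\lambda$ is a measure on $\{-1,1\}$ with $0<\lambda(\{-1,1\})\le\infty$ (the spherical component) and, for each $\xi\in\{-1,1\}$, $\nu_\xi$ is a measure on $(0,\infty)$ with $0<\nu_\xi((0,\infty))\le\infty$ (the radial component). Bercovici–Pata bijection. $\Lambda$ is the Bercovici–Pata bijection from classical infinitely divisible distributions on $\mathbb{R}$ to free infinitely divisible distributions on $\mathbb{R}$: if $\mathcal{C}_\mu(z)=i\gamma z+\int_{\mathbb{R}}\left(e^{izx}-1-\frac{izx}{1+x^2}\right)\frac{1+x^2}{x^2}\,\sigma(dx)$ with $\gamma\in\mathbb{R}$ and $\sigma$ a finite measure on $\mathbb{R}$ (integrand at $x=0$ equal to $-z^2/2$), then $\Lambda(\mu)$ is the probability measure whose Voiculescu transform is $\phi(z)=\gamma+\int_{\mathbb{R}}\frac{1+xz}{z-x}\,\sigma(dx)$. (The Voiculescu transform of a probability measure $\rho$ is $\phi_\rho(z)=F_\rho^{-1}(z)-z$ on a suitable truncated cone in the upper half plane, where $F_\rho(z)=1/\int\frac{\rho(dx)}{z-x}$.) Random matrix model. A random matrix model for a probability measure $\rho$ on $\mathbb{R}$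 is a sequence $(M_d)_{d\ge1}$ of random $d\times d$ matrices whose (random) empirical spectral distributions $\frac1d\sum_{i=1}^d\delta_{\lambda_i}$ ($\lambda_1,\dots,\lambda_d$ the eigenvalues of $M_d$) converge weakly to $\rho$ as $d\to\infty$ (convergence in probability with respect to the topology of weak convergence). *)

(* Defs.v *)
From HB Require Import structures.
From mathcomp Require Export all_boot all_order all_algebra.
From mathcomp Require Export complex.
From mathcomp Require Export all_classical all_reals all_analysis.

Set Implicit Arguments.
Unset Strict Implicit.
Unset Printing Implicit Defensive.

Import Order.TTheory GRing.Theory Num.Theory.
Import numFieldNormedType.Exports.

Local Open Scope classical_set_scope.
Local Open Scope ring_scope.
Local Open Scope sesquilinear_scope.
Local Open Scope complex_scope.

(* The usual topology of the complex plane, and the Borel sigma-algebra of the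
   space of complex m x n matrices. *)
HB.instance Definition _ (R : rcfType) := PseudoPointedMetric.copy R[i] R[i]^o.

HB.instance Definition _ (R : realType) (m n : nat) :=
  Measurable.copy 'M[R[i]]_(m, n) (g_sigma_algebraType (@open 'M[R[i]]_(m, n))).

Section complex_analysis.
Context {R : realType}.

Definition cexp (z : R[i]) : R[i] :=
  (expR (complex.Re z) * cos (complex.Im z)) +i*
  (expR (complex.Re z) * sin (complex.Im z)).

Definition cintegral {d} {T : measurableType d}
    (mu : {measure set T -> \bar R}) (f : T -> R[i]) : R[i] :=
  (\int[mu]_x complex.Re (f x)) +i* (\int[mu]_x complex.Im (f x)).

End complex_analysis.

Section laws_on_the_line.
Context {R : realType}.
Local Notation RB := (measurableTypeR R).
Implicit Types (mu rho : probability RB R).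

Definition charfun mu (z : R) : R[i] :=
  cintegral mu (fun x : RB => cexp ('i * (z * x)%:C)).

Fixpoint convolution_power mu (n : nat) : set RB -> \bar R :=
  if n is m.+1 then
    fun B => (\int[mu]_x convolution_power mu m [set y : RB | B (x + y)%R])%E
  else \d_(0 : RB).

Definition infinitely_divisible mu := forall n : nat, (0 < n)%N ->
  exists mun : probability RB R,
    forall B : set RB, measurable B -> mu B = convolution_power mun n B.

Definition is_cumulant_transform mu (C : R -> R[i]) :=
  [/\ continuous C, C 0 = 0 & forall z, charfun mu z = cexp (C z)].

(* Levy-Khintchine representation with truncation function x / (1 + x ^ 2);
   the Levy measure does not depend on the choice of the truncation. *)
Definition is_levy_measure mu (nu : {measure set RB -> \bar R}) :=
  [/\ nu [set 0] = 0%E,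
      (\int[nu]_x (Num.min 1 (x ^+ 2))%:E < +oo)%E &
      exists gamma a : R, 0 <= a /\ forall z : R,
        charfun mu z =
        cexp ('i * (gamma * z)%:C - (a * z ^+ 2 / 2)%:C +
              cintegral nu (fun x : RB => cexp ('i * (z * x)%:C) - 1
                              - 'i * (z * x / (1 + x ^+ 2))%:C))].

(* Measures on {-1, 1} and on (0, oo) are represented by measures on the real
   line which are concentrated there; only nu_ 1 and nu_ (-1) matter. *)
Definition is_polar_decomposition (nu lambda : {measure set RB -> \bar R})
    (nu_ : R -> {measure set RB -> \bar R}) :=
  [/\ lambda (~` [set -1; 1]) = 0%E,
      (0 < lambda [set (-1)%R; 1%R])%E,
      forall xi : R, [set -1; 1] xi ->
        nu_ xi (~` `]0, +oo[%classic) = 0%E /\ (0 < nu_ xi `]0%R, +oo[%classic)%E &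
      forall B : set RB, measurable B ->
        nu B = (\int[lambda]_(xi in [set (-1)%R; 1%R])
                  \int[nu_ xi]_(r in `]0%R, +oo[) (\1_B (r * xi)%R)%:E)%E].

Definition cauchy_transform rho (z : R[i]) : R[i] :=
  cintegral rho (fun x : RB => (z - (x : R)%:C)^-1).

Definition reciprocal_cauchy rho (z : R[i]) : R[i] := (cauchy_transform rho z)^-1.

Definition truncated_cone (alpha beta : R) : set R[i] :=
  [set z | `|complex.Re z| < alpha * complex.Im z /\ beta < complex.Im z].

(* phi z = F^-1 z - z on the truncated cone (alpha, beta), where F^-1 is the
   inverse of the restriction of F to a truncated cone (eta, M) on which F is
   injective. *)
Definition is_voiculescu_transform rho (phi : R[i] -> R[i]) :=
  exists eta M alpha beta : R,
    [/\ [/\ 0 < eta, 0 < M, 0 < alpha & 0 < beta],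
        {in truncated_cone eta M &, injective (reciprocal_cauchy rho)} &
        forall z, truncated_cone alpha beta z ->
          truncated_cone eta M (z + phi z) /\
          reciprocal_cauchy rho (z + phi z) = z].

Definition bercovici_pata_kernel (z x : R) : R[i] :=
  if x == 0 then - (z ^+ 2 / 2)%:C
  else (cexp ('i * (z * x)%:C) - 1 - 'i * (z * x / (1 + x ^+ 2))%:C)
       * ((1 + x ^+ 2) / x ^+ 2)%:C.

(* rho is the image of mu under the Bercovici-Pata bijection. *)
Definition bercovici_pata mu rho :=
  exists (C : R -> R[i]) (gamma : R)
         (sigma : {finite_measure set RB -> \bar R}),
    [/\ is_cumulant_transform mu C,
        forall z : R, C z = 'i * (gamma * z)%:C +
          cintegral sigma (fun x : RB => bercovici_pata_kernel z x) &
        is_voiculescu_transform rho (fun z => gamma%:C +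
          cintegral sigma
            (fun x : RB => (1 + (x : R)%:C * z) / (z - (x : R)%:C)))].

End laws_on_the_line.

Section hermitian_matrices.
Context {R : realType}.
Local Notation RB := (measurableTypeR R).

Definition herm (d : nat) : set 'M[R[i]]_d := [set A | A \is hermsymmx].
Arguments herm : clear implicits.

Definition mxnorm2 (d : nat) (A : 'M[R[i]]_d) : R :=
  Num.sqrt (complex.Re (\tr (A *m A^t*))).

Definition rank1_sphere (d : nat) : set 'M[R[i]]_d :=
  [set V | [/\ herm d V, \rank V = 1%N & mxnorm2 V = 1]].
Arguments rank1_sphere : clear implicits.

(* x^* A x is a complex number; 0 <= z in R[i] entails that z is real. *)
Definition psdmx (d : nat) (A : 'M[R[i]]_d) : Prop :=
  herm d A /\ forall x : 'cV[R[i]]_d, 0 <= (x^t* *m A *m x) 0 0.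

Definition rank1_sphere_pos (d : nat) : set 'M[R[i]]_d :=
  [set V | rank1_sphere d V /\ psdmx V].
Arguments rank1_sphere_pos : clear implicits.

Definition radial_component (nu_ : R -> {measure set RB -> \bar R})
    (d : nat) (V : 'M[R[i]]_d) : {measure set RB -> \bar R} :=
  if `[< psdmx V >] then nu_ 1 else nu_ (-1).

Definition sqnormC (d : nat) (x : 'cV[R[i]]_d) : R :=
  complex.Re ((x^t* *m x) 0 0).

Definition real_isometry (d : nat) (f : 'cV[R[i]]_d -> 'cV[R[i]]_d) :=
  [/\ forall x y, f (x + y) = f x + f y,
      forall (r : R) x, f (r%:C *: x) = r%:C *: f x &
      forall x, sqnormC (f x) = sqnormC x].

(* The uniform distribution on the unit sphere of C^d = R^(2d) is the
   probability carried by the sphere that is invariant under the orthogonal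
   group O(2d). *)
Definition uniform_on_sphere {dsp} {Q : measurableType dsp}
    (P : probability Q R) (d : nat) (u : {RV P >-> 'cV[R[i]]_d}) :=
  distribution P u [set x | sqnormC x = 1] = 1%E /\
  forall f : 'cV[R[i]]_d -> 'cV[R[i]]_d, real_isometry f ->
    forall B : set 'cV[R[i]]_d, measurable B ->
      distribution P u (f @^-1` B) = distribution P u B.

(* The law omega_d of u u^*. *)
Definition omega {dsp} {Q : measurableType dsp}
    (P : probability Q R) (d : nat) (u : {RV P >-> 'cV[R[i]]_d}) :
    set 'M[R[i]]_d -> \bar R :=
  pushforward P (fun w => u w *m (u w)^t*).

(* Empirical spectral distribution of a hermitian matrix. *)
Definition esd (d : nat) (A : 'M[R[i]]_d) : set RB -> \bar R :=
  fun B => ((d%:R^-1)%R%:E *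
    \sum_(i < d) \d_(complex.Re (spectral_diag A 0%R i) : RB) B)%E.

(* Convergence in probability of the empirical spectral distributions to rho
   for the topology of weak convergence, tested on the subbasic
   neighbourhoods of rho. *)
Definition random_matrix_model {dsp : nat -> measure_display}
    {Q : forall d, measurableType (dsp d)}
    (P : forall d, probability (Q d) R)
    (M : forall d, {RV (P d) >-> 'M[R[i]]_d}) (rho : probability RB R) :=
  forall f : R -> R, continuous f -> (exists K : R, forall x, `|f x| <= K) ->
  forall e : R, 0 < e ->
    (fun d => P d [set w | e <= `|fine (\int[esd (M d w)]_x (f x)%:E)
                                   - fine (\int[rho]_x (f x)%:E)|])
      @ \oo --> 0%E.

(* Q is a covariance form on the real vector space of hermitian matrices. *)
Definition covariance_form (d : nat) (Q : 'M[R[i]]_d -> 'M[R[i]]_d -> R) :=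
  [/\ forall (r : R) A B C, herm d A -> herm d B -> herm d C ->
        Q (r%:C *: A + B) C = r * Q A C + Q B C,
      forall A B, herm d A -> herm d B -> Q A B = Q B A &
      forall A, herm d A -> 0 <= Q A A].

(* nuX is the Levy measure of the random hermitian matrix X: Levy-Khintchine
   representation on the Euclidean space of hermitian matrices.  nuX is a
   measure on all complex matrices, carried by the nonzero hermitian ones. *)
Definition is_levy_measure_mx {dsp} {Q : measurableType dsp}
    (P : probability Q R) (d : nat) (X : {RV P >-> 'M[R[i]]_d})
    (nuX : {measure set 'M[R[i]]_d -> \bar R}) :=
  [/\ nuX (~` (herm d `\ 0)) = 0%E,
      (\int[nuX]_Y (Num.min 1 (mxnorm2 Y ^+ 2))%:E < +oo)%E &
      exists (Psi : 'M[R[i]]_d) (Cov : 'M[R[i]]_d -> 'M[R[i]]_d -> R),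
        [/\ herm d Psi, covariance_form Cov & forall A, herm d A ->
          cintegral P (fun w => cexp ('i * \tr (X w *m A))) =
          cexp ('i * \tr (Psi *m A) - (Cov A A / 2)%:C +
                cintegral nuX (fun Y => cexp ('i * \tr (Y *m A)) - 1
                  - 'i * (\tr (Y *m A) / (1 + mxnorm2 Y ^+ 2)%:C)))]].

End hermitian_matrices.
Arguments herm {R} d.
Arguments rank1_sphere {R} d.
Arguments rank1_sphere_pos {R} d.

(* Main.v *)
(* Let V = u u^* and let nu_M be d times the image of (law of V) x nu under
   (V, x) |-> x V.  Since tr (x V A) = x <u, A u> and |x V| = |x|, Fubini turns
   the Levy-Khintchine integral of nu_M into d E_u of that of nu evaluated at
   <u, A u>; and C_mu is the Levy-Khintchine exponent of mu, because two
   continuous logarithms of the same function which agree at 0 coincide.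
   Splitting the jumps x according to their sign, and writing nu on each
   half-line as lambda {xi} nu_xi, gives the polar form of nu_M, with
   Pi = lambda {1} law (V) + lambda {-1} law (- V). *)

(* Three obstacles shape the formal argument. First, [u] is a unit vector only almost surely;
   replacing [u u^*] by a version that is a rank one projector everywhere makes every bound on
   [tr (V A)] hold pointwise. The Levy-Khintchine kernel is then dominated by a constant times
   [min(1, x ^ 2)], uniformly in the sample point, which is the integrability Fubini asks for; the
   sigma-finiteness of [nu] comes from Markov's inequality for [min(1, x ^ 2)]. Second, a polar
   decomposition allows [lambda {xi}] to be infinite and [nu_ xi] not to be sigma-finite. An
   infinite mass is refuted, because [nu] has finite tails while [nu_ xi] is nonzero. If the mass is
   positive, integrals of [nu_ xi] along a ray are values of [nu] divided by [lambda {xi}], hence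
   measurable in [V]; if it is zero, measurability may fail, so integrals are compared off a null
   set with no measurability assumption. Third, all measures live on the full space of complex
   matrices, so rank one projectors are described by polynomial equations, which makes them a Borel
   set. *)
From HB Require Import structures.
Require Import Defs.
From mathcomp Require Import ring lra measurable_realfun.

Set Implicit Arguments.
Unset Strict Implicit.
Unset Printing Implicit Defensive.

Import Order.TTheory GRing.Theory Num.Theory.
Import numFieldNormedType.Exports.

Local Open Scope classical_set_scope.
Local Open Scope ring_scope.
Local Open Scope sesquilinear_scope.
Local Open Scope complex_scope.

(** * The Levy-Khintchine kernel *)

Section trigonometric_bounds.
Context {R : realType}.
Implicit Types t : R.

Lemma norm_sin_le t : `|sin t| <= `|t|.
Proof.
wlog t0 : t / 0 <= t => [hw|].
  have [/hw //|/ltW t0] := leP 0 t.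
  by have := hw (- t); rewrite sinN !normrN oppr_ge0; exact.
have [|c _] := @MVT_segment R sin cos 0 t t0.
  exact/continuous_subspaceT/continuous_sin.
rewrite sin0 !subr0 => ->.
by rewrite normrM ler_piMl// cos_max.
Qed.

Lemma subr1_cos t : 1 - cos t = 2 * sin (t / 2) ^+ 2.
Proof.
have {1}-> : t = (t / 2) *+ 2 by rewrite -mulr_natr divfK ?pnatr_eq0.
by rewrite cos_mulr2n cos2sin2; ring.
Qed.

Lemma norm_cos_sub1_le2 t : `|cos t - 1| <= 2.
Proof. by have := cos_max t; rewrite !ler_norml; lra. Qed.

Lemma norm_cos_sub1_le t : `|cos t - 1| <= t ^+ 2.
Proof.
rewrite distrC subr1_cos normrM normrX ger0_norm//.
have := norm_sin_le (t / 2); rewrite normrM normfV (normr_nat _ 2) => h.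
have h2 : `|sin (t / 2)| ^+ 2 <= (`|t| * 2^-1) ^+ 2 by rewrite lerXn2r// nnegrE.
have : `|t| ^+ 2 = t ^+ 2 by rewrite real_normK ?num_real.
by move: h2; rewrite exprMn; have := sqr_ge0 t; nra.
Qed.

Lemma norm_sin_sub_le t : `|sin t - t| <= 2 * t ^+ 2.
Proof.
wlog t0 : t / 0 <= t => [hw|].
  have [/hw //|/ltW t0] := leP 0 t.
  by have := hw (- t); rewrite sinN -opprD normrN sqrrN oppr_ge0; exact.
have [|c] := @MVT_segment R (fun x => sin x - x) (fun x => cos x - 1) 0 t t0.
  apply/continuous_subspaceT => x.
  by apply: cvgB; [exact: continuous_sin|exact: cvg_id].
rewrite in_itv/= => /andP[c0 ct].
rewrite sin0 !subr0 => ->.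
rewrite normrM (ger0_norm t0) expr2 mulrA ler_wpM2r//.
(* The derivative must be at most [2 * t] in absolute value: for [1 <= t] the bound 2 suffices, and
   below 1 the bound [c ^ 2 <= t ^ 2 <= t] does. *)
have [t1|t1] := leP 1 t; first by have := norm_cos_sub1_le2 c; lra.
by have := norm_cos_sub1_le c; nra.
Qed.

End trigonometric_bounds.

Section levy_kernel.
Context {R : realType}.
Implicit Types z x : R.

Definition kernel_re z x : R := cos (z * x) - 1.
Definition kernel_im z x : R := sin (z * x) - z * x / (1 + x ^+ 2).

(** A crude majorant for both kernels: [2] covers the trigonometric terms for large [x], [|z|] the
    compensator, and [2 * z ^+ 2] the second order remainders near 0. It grows with [|z|], so it is
    uniform over bounded sets of [z]. *)
Definition kernel_bound z : R := 2 + `|z| + 2 * z ^+ 2.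

Lemma le_kernel_bound y z : `|y| <= z -> kernel_bound y <= kernel_bound z.
Proof.
move=> yz; rewrite /kernel_bound.
have z0 : 0 <= z by exact: le_trans yz.
have : `|y| ^+ 2 <= z ^+ 2 by rewrite lerXn2r// nnegrE.
by rewrite real_normK ?num_real// (ger0_norm z0); lra.
Qed.

Lemma kernel_re_bound z x :
  `|kernel_re z x| <= kernel_bound z * Num.min 1 (x ^+ 2).
Proof.
have := normr_ge0 z; have := sqr_ge0 z; have := sqr_ge0 x.
rewrite /kernel_bound; have [x1|x1] := leP 1 (x ^+ 2) => x0 z0 z1.
  by have := norm_cos_sub1_le2 (z * x); rewrite /kernel_re; lra.
by have := norm_cos_sub1_le (z * x); rewrite /kernel_re exprMn; nra.
Qed.

Lemma kernel_im_bound z x :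
  `|kernel_im z x| <= kernel_bound z * Num.min 1 (x ^+ 2).
Proof.
have x0 : 0 <= x ^+ 2 := sqr_ge0 x.
have z0 := sqr_ge0 z; have z1 := normr_ge0 z.
have D0 : 0 < 1 + x ^+ 2 by rewrite ltr_pwDl.
have nx := normr_ge0 x.
have nx2 : `|x| ^+ 2 = x ^+ 2 by rewrite real_normK ?num_real.
rewrite /kernel_bound; have [x1|x1] := leP 1 (x ^+ 2).
  rewrite /kernel_im (le_trans (ler_normB _ _))// normrM normfV !normrM.
  rewrite (ger0_norm (ltW D0)).
  have : `|x| / (1 + x ^+ 2) <= 1 by rewrite ler_pdivrMr// -nx2; nra.
  have := sin_max (z * x).
  have : 0 <= `|x| / (1 + x ^+ 2) by rewrite divr_ge0// ltW.
  by rewrite mulrAC -[X in _ -> _ -> _ -> _ + X <= _]mulrA mulrC; nra.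
(* For small [x] the compensator is compared with the linear term [z * x]; the error is of order
   [x ^ 3], and the rest is the remainder [sin t - t]. *)
have -> : kernel_im z x =
    (sin (z * x) - z * x) + z * x * (x ^+ 2 / (1 + x ^+ 2)).
  by rewrite /kernel_im; field; rewrite gt_eqF.
rewrite (le_trans (ler_normD _ _))//.
have := norm_sin_sub_le (z * x); rewrite exprMn => h.
have : `|z * x * (x ^+ 2 / (1 + x ^+ 2))| <= `|z| * x ^+ 2.
  rewrite -mulrA normrM ler_wpM2l// mulrCA normrM (ger0_norm x0).
  rewrite ler_piMr// normrM normfV (ger0_norm (ltW D0)).
  by rewrite ler_pdivrMr// -nx2; nra.
by nra.
Qed.

Lemma continuous_kernel_im x : continuous (fun z => kernel_im z x).
Proof.
move=> z; apply: cvgB.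
  apply: (@cvg_comp _ _ _ ( *%R^~ x) sin); first exact: mulrr_continuous.
  exact: continuous_sin.
apply: cvgM; last exact: cvg_cst.
exact: mulrr_continuous.
Qed.

Lemma cexp_imaginary (t : R) : cexp ('i * t%:C) = cos t +i* sin t.
Proof. by rewrite /cexp /= !mul0r !mul1r subrr add0r expR0 !mul1r. Qed.

Lemma levy_kernelE z x : cexp ('i * (z * x)%:C) - 1
    - 'i * (z * x / (1 + x ^+ 2))%:C = kernel_re z x +i* kernel_im z x.
Proof.
rewrite cexp_imaginary; apply/eqP; rewrite eq_complex /=.
by rewrite !mul0r !mul1r !subr0 add0r !eqxx.
Qed.

(** Comparing squared moduli eliminates the arguments, and [expR] is injective. *)
Lemma cexp_eq_Re (v w : R[i]) : cexp v = cexp w -> complex.Re v = complex.Re w.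
Proof.
move=> [] h1 h2; apply: expR_inj.
have : (expR (complex.Re v)) ^+ 2 = (expR (complex.Re w)) ^+ 2.
  rewrite -[LHS]mulr1 -[RHS]mulr1 -{1}(cos2Dsin2 (complex.Im v)).
  by rewrite -(cos2Dsin2 (complex.Im w)) !mulrDr -!exprMn h1 h2.
by move/eqP; rewrite eqrXn2 ?expR_ge0// => /eqP.
Qed.

(** The conclusion encodes that the imaginary parts differ by a multiple of 2 pi, in a form suited
    to a continuity argument. *)
Lemma cexp_eq_Im (v w : R[i]) : cexp v = cexp w ->
  cos (complex.Im v - complex.Im w) = 1.
Proof.
move=> vw; have rvw := cexp_eq_Re vw; move: vw => [].
rewrite rvw => /(mulfI (lt0r_neq0 (expR_gt0 _))) h1.
move=> /(mulfI (lt0r_neq0 (expR_gt0 _))) h2.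
by rewrite cosB h1 h2 -!expr2 cos2Dsin2.
Qed.

(** A continuous function with values in the multiples of 2 pi cannot leave 0: by the intermediate
    value theorem it would reach a small level where [cos] is below 1. The two reductions reflect
    the argument, to get [0 <= z], then the sign, to leave a one-sided bound. *)
Lemma continuous_cos_eq1 (g : R -> R) : continuous g -> g 0 = 0 ->
  (forall z, cos (g z) = 1) -> forall z, g z = 0.
Proof.
move=> cg g0 gc.
suff H (h : R -> R) : continuous h -> h 0 = 0 -> (forall z, cos (h z) = 1) ->
    forall z, 0 <= z -> h z = 0.
  move=> z; have [/(H g cg g0 gc) //|z0] := leP 0 z.
  rewrite -(opprK z); apply: (H (fun z => g (- z))).
  - move=> y; apply: continuous_comp; first exact: opp_continuous.
    exact: cg.
  - by rewrite oppr0.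
  - by [].
  - by rewrite oppr_ge0 ltW.
move=> ch h0 hc z z0.
suff H (k : R -> R) : continuous k -> k 0 = 0 -> (forall z, cos (k z) = 1) ->
    k z <= 0.
  apply/eqP; rewrite eq_le H//= -oppr_le0 (H (fun z => - h z))//.
  - by move=> y; apply: cvgN; exact: ch.
  - by rewrite h0 oppr0.
  - by move=> y; rewrite cosN.
move=> ck k0 kc; rewrite leNgt; apply/negP => kz.
(* The cap at 1 keeps the level inside [[0, pi]], where [cos] is strictly decreasing. *)
pose v := Num.min (k z) 1.
have [v0 v1 vk] : [/\ 0 < v, v <= 1 & v <= k z].
  by rewrite /v lt_min kz ltr01 !ge_min !lexx orbT.
have [||c _ kcv] := @IVT R k 0 z v z0.
- exact: continuous_subspaceT.
- by rewrite k0 minElt kz maxElt kz (ltW v0).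
have := kc c; rewrite kcv => cv.
have : cos v < cos 0.
  have p2 := pi_ge2 R.
  rewrite ltr_cos// in_itv/=; apply/andP; split; lra.
by rewrite cos0 cv ltxx.
Qed.

End levy_kernel.

(** * Borel measurability of complex matrices *)

Section complex_matrix_measurability.
Context {R : realType}.

Lemma le_normc_ReIm (z : R[i]) :
  `|z| <= (`|complex.Re z| + `|complex.Im z|)%:C.
Proof.
rewrite [z in `|z|]complexE (le_trans (ler_normD _ _))// normrM.
rewrite !normc_def /= !expr0n /= !add0r !addr0 expr1n sqrtr1 mul1r.
by rewrite !sqrtr_sqr -rmorphD.
Qed.

Lemma continuous_Re : continuous (@complex.Re R : R[i] -> R).
Proof.
move=> z A /nbhs_ballP[e e0 eA].
apply/(@nbhs_ballP R[i] R[i]); exists e%:C; first by rewrite /= ltcR.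
move=> w /= zw; apply: eA; move: zw; rewrite -ball_normE /= -ltcR; apply: le_lt_trans.
by rewrite -raddfB normc_ge_Re.
Qed.

Lemma continuous_Im : continuous (@complex.Im R : R[i] -> R).
Proof.
have -> : @complex.Im R = (@complex.Re R) \o (fun z => - 'i * z).
  by apply/funext => -[a b] /=; rewrite oppr0 mul0r mulN1r opprK add0r.
move=> z; apply: (@continuous_comp _ _ _ (fun z => - 'i * z : R[i])).
  exact: (@mulrl_continuous R[i]).
exact: continuous_Re.
Qed.

Lemma measurable_coord_continuous m n (i : 'I_m) (j : 'I_n) (h : R[i] -> R) :
  continuous h ->
  measurable_fun [set: 'M[R[i]]_(m, n)] (fun A : 'M[R[i]]_(m, n) => h (A i j)).
Proof.
move=> ch; apply: (measurability _ (RGenOpens.measurableE R)).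
move=> _ [_ [a [b ->] <-]]; rewrite setTI.
apply: sub_sigma_algebra.
have : continuous (fun A : 'M[R[i]]_(m, n) => h (A i j)).
  move=> A; apply: (@continuous_comp _ _ _ (fun A : 'M[R[i]]_(m, n) => A i j)).
    exact: coord_continuous.
  exact: ch.
by move/continuousP; apply; exact: interval_open.
Qed.

Lemma measurable_fun_coord d (T : measurableType d) m n
    (f : T -> 'M[R[i]]_(m, n)) (i : 'I_m) (j : 'I_n) (h : R[i] -> R) :
  measurable_fun setT f -> continuous h ->
  measurable_fun setT (fun t => h (f t i j)).
Proof.
move=> mf ch.
exact: (measurableT_comp (measurable_coord_continuous i j ch) mf).
Qed.

(* Rational boxes form a countable base of the topology of complex matrices. *)
Lemma measurable_fun_mx d (T : measurableType d) m n
    (f : T -> 'M[R[i]]_(m, n)) :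
  (forall i j, measurable_fun setT (fun t => complex.Re (f t i j))) ->
  (forall i j, measurable_fun setT (fun t => complex.Im (f t i j))) ->
  measurable_fun setT f.
Proof.
move=> mRe mIm; pose ix := 'M[(rat * rat) * (rat * rat)]_(m, n).
pose in_box (q : (rat * rat) * (rat * rat)) (z : R[i]) :=
  (ratr q.1.1 < complex.Re z < ratr q.1.2) &&
  (ratr q.2.1 < complex.Im z < ratr q.2.2).
pose box (c : ix) := [set A : 'M[R[i]]_(m, n) | forall i j, in_box (c i j) (A i j)].
have mbox c : measurable (f @^-1` box c).
  have -> : f @^-1` box c =
      \bigcap_(k in [set: 'I_m * 'I_n]) [set t | in_box (c k.1 k.2) (f t k.1 k.2)].
    by apply/seteqP; split=> [t + k _|t + i j]; [exact|move/(_ (i, j) I)].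
  apply: fin_bigcap_measurable; first exact: finite_finset.
  move=> [i j] _ /=.
  rewrite [X in measurable X](_ : _ =
      (fun t => complex.Re (f t i j)) @^-1`
        `](ratr (c i j).1.1 : R), (ratr (c i j).1.2)[ `&`
      (fun t => complex.Im (f t i j)) @^-1`
        `](ratr (c i j).2.1 : R), (ratr (c i j).2.2)[).
    by apply: measurableI; rewrite -[X in measurable X]setTI;
      [exact: mRe|exact: mIm].
  by apply/seteqP; split=> t /=; rewrite /in_box !in_itv/= => /andP.
apply: (@measurability _ _ _ _ _ _ (@open 'M[R[i]]_(m, n))) => // _ [U oU <-].
rewrite setTI [X in measurable X](_ : _ =
    \bigcup_(c : ix) (if `[< box c `<=` U >] then f @^-1` box c else set0)).
  apply: countable_bigcupT_measurable => [|c]; first exact: countableP.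
  by case: ifPn.
apply/seteqP; split=> [t Ut|t [c _]]; last first.
  by case: ifPn => // /asboolP cU /cU.
have /(@nbhs_ballP R[i] 'M[R[i]]_(m, n))[e /= e0 eU] : nbhs (f t) U.
  exact: open_nbhs_nbhs.
(* The radius is an element of [R[i]]; positivity makes it real. Half of it is spent on the real
   parts of the entries and half on the imaginary parts. *)
have [r r0 er] : exists2 r : R, 0 < r & e = (2 * r)%:C.
  exists (complex.Re e / 2).
    by rewrite divr_gt0//; move: e0; rewrite ltcE /= => /andP[].
  rewrite mulrC divfK ?pnatr_eq0//; case: e e0 {eU} => a b.
  by rewrite ltcE /= => /andP[/eqP -> _].
have approx (x : R) : exists q : rat * rat,
    [/\ ratr q.1 < x < ratr q.2, x - r < ratr q.1 & ratr q.2 < x + r].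
  have [|q1] := @rat_in_itvoo R (x - r) x; first by rewrite ltrBlDr ltrDl.
  have [|q2] := @rat_in_itvoo R x (x + r); first by rewrite ltrDl.
  rewrite !in_itv/= => /andP[h1 h2] /andP[h3 h4].
  by exists (q1, q2); rewrite h1 h2 h3 h4.
pose c : ix := \matrix_(i, j) (projT1 (cid (approx (complex.Re (f t i j)))),
                              projT1 (cid (approx (complex.Im (f t i j))))).
exists c => //; rewrite ifT.
  move=> i j; rewrite /in_box mxE /=.
  by case: cid => ? [/= -> _ _]; case: cid => ? [/= -> _ _].
apply/asboolP => A Ac; apply: eU; split => // i j.
have := Ac i j; rewrite /in_box mxE /=.
case: cid => -[a1 a2] [/= _ a3 a4]; case: cid => -[b1 b2] [/= _ b3 b4].
move=> /andP[/andP[h1 h2] /andP[h3 h4]].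
change (`|f t i j - A i j| < e); apply: le_lt_trans (le_normc_ReIm _) _.
rewrite er ltcR !raddfB /= mulrDl mul1r ltrD// ltr_norml; apply/andP; split; lra.
Qed.

End complex_matrix_measurability.

(** * Rank one hermitian matrices *)

Section rank_one_matrices.
Context {R : realType}.
Variable d : nat.
Implicit Types A V : 'M[R[i]]_d.

Lemma hermP A : herm d A <-> forall i j, A i j = ((A j i)^*)%C.
Proof.
rewrite /herm /=; split=> [/is_hermitianmxP/matrixP + i j|h].
  by move/(_ i j); rewrite expr0 scale1r !mxE.
by apply/is_hermitianmxP/matrixP => i j; rewrite expr0 scale1r !mxE; exact: h.
Qed.

Lemma hermZ (x : R) A : herm d A -> herm d (x%:C *: A).
Proof.
move=> /hermP hA; apply/hermP => i j; rewrite !mxE [in LHS]hA rmorphM.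
by congr (_ * _); rewrite /= oppr0.
Qed.

Lemma mxtraceM_coord m n (B : 'M[R[i]]_(m, n)) (C : 'M[R[i]]_(n, m)) :
  \tr (B *m C) = \sum_i \sum_j B i j * C j i.
Proof. by apply: eq_bigr => i _; rewrite mxE. Qed.

Lemma mxtrace_mul_adj A : \tr (A *m A^t*) =
  (\sum_i \sum_j ((complex.Re (A i j)) ^+ 2 + (complex.Im (A i j)) ^+ 2))%:C.
Proof.
rewrite mxtraceM_coord rmorph_sum/=; apply: eq_bigr => i _.
rewrite rmorph_sum/=; apply: eq_bigr => j _.
by rewrite add_Re2_Im2 sqr_normc !mxE.
Qed.

Lemma sqr_mxnorm2 A : mxnorm2 A ^+ 2 =
  \sum_i \sum_j ((complex.Re (A i j)) ^+ 2 + (complex.Im (A i j)) ^+ 2).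
Proof.
rewrite /mxnorm2 mxtrace_mul_adj/= sqr_sqrtr//.
by apply: sumr_ge0 => i _; apply: sumr_ge0 => j _; rewrite addr_ge0// sqr_ge0.
Qed.

Lemma mxnorm2_ge0 A : 0 <= mxnorm2 A.
Proof. exact: sqrtr_ge0. Qed.

Lemma herm_sqr_mxnorm2 A : herm d A -> (mxnorm2 A ^+ 2)%:C = \tr (A *m A).
Proof.
move=> /hermP hA; rewrite sqr_mxnorm2 -mxtrace_mul_adj; congr (\tr (_ *m _)).
by apply/matrixP => i j; rewrite !mxE; rewrite [RHS]hA.
Qed.

(** Rank at most one as polynomial equations in the entries, from which measurability can be read
    off. *)
Definition minors2_eq0 V := forall i j k l, V i j * V k l = V i l * V k j.

(** Around a nonzero entry [V k l], the vanishing minors factor [V] as its column [l] times its row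
    [k] divided by [V k l]. *)
Lemma mxrank1P V : \rank V = 1%N <-> V != 0 /\ minors2_eq0 V.
Proof.
split=> [rV|[V0 mV]].
  split; first by rewrite -mxrank_eq0 rV.
  have := mulmx_base V; move: (col_base V) (row_base V); rewrite rV => C D <-.
  by move=> i j k l; rewrite !mxE !big_ord1; ring.
have [k [l Vkl]] : exists k l, V k l != 0.
  apply: contrapT => h; case/eqP: V0; apply/matrixP => i j; rewrite mxE.
  by apply/eqP; apply: contra_notT h => Vij; exists i, j.
apply/eqP; rewrite eqn_leq lt0n mxrank_eq0 V0 andbT.
have -> : V = col l V *m ((V k l)^-1 *: row k V).
  apply/matrixP => i j; rewrite !mxE big_ord1 !mxE.
  by rewrite mulrCA -mV mulrC mulfK.
exact: mulmx_max_rank.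
Qed.

(* The orthogonal projectors of rank one, by polynomial equations in the
   entries. *)
Definition rank1_projector : set 'M[R[i]]_d :=
  [set V | [/\ herm d V, minors2_eq0 V & \tr V = 1]].

(** Exchanging column indices turns [V i k * V k j] into [V i j * V k k]; the sum over [k] then
    produces the trace. *)
Lemma minors2_eq0_sqr V : minors2_eq0 V -> V *m V = \tr V *: V.
Proof.
move=> mV; apply/matrixP => i j; rewrite !mxE mulr_suml; apply: eq_bigr => k _.
by rewrite mulrC mV mulrC.
Qed.

Lemma rank1_projector_idem V : rank1_projector V -> V *m V = V.
Proof. by move=> [_ mV tV]; rewrite minors2_eq0_sqr// tV scale1r. Qed.

Lemma rank1_projector_norm V : rank1_projector V -> mxnorm2 V ^+ 2 = 1.
Proof.
move=> pV; apply: complexI; rewrite herm_sqr_mxnorm2; last by case: pV.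
by rewrite rank1_projector_idem//; case: pV.
Qed.

Lemma hermN V : herm d (- V) <-> herm d V.
Proof.
split=> /hermP h; apply/hermP => i j; have := h i j; rewrite !mxE ?rmorphN.
  by move/oppr_inj.
by move=> ->.
Qed.

Lemma minors2_eq0N V : minors2_eq0 (- V) <-> minors2_eq0 V.
Proof.
by split=> h i j k l; have := h i j k l; rewrite !mxE !mulrNN.
Qed.

Lemma mxnorm2N V : mxnorm2 (- V) ^+ 2 = mxnorm2 V ^+ 2.
Proof.
rewrite !sqr_mxnorm2; apply: eq_bigr => i _; apply: eq_bigr => j _.
by rewrite mxE !raddfN /= !sqrrN.
Qed.

Lemma rank1_sphereN V : rank1_sphere d (- V) <-> rank1_sphere d V.
Proof.
suff H (W : 'M[R[i]]_d) : rank1_sphere d W -> rank1_sphere d (- W).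
  by split=> [/H|/H//]; rewrite opprK.
move=> [hW rW nW]; split; [exact/hermN|by rewrite mxrank_opp|].
by apply/eqP; rewrite -(@eqrXn2 _ 2)// ?mxnorm2_ge0// mxnorm2N nW.
Qed.

Lemma rank1_projector_sphere V : rank1_projector V -> rank1_sphere d V.
Proof.
move=> pV; have nV := rank1_projector_norm pV; case: (pV) => hV mV tV.
split => //; last first.
  by apply/eqP; rewrite -(@eqrXn2 _ 2)// ?mxnorm2_ge0// nV expr1n.
apply/mxrank1P; split => //; apply/eqP => V0.
by move: tV; rewrite V0 mxtrace0 => /esym/eqP; rewrite oner_eq0.
Qed.

(** A hermitian [V] of rank one satisfies [V ^ 2 = tr V * V], so
    [(tr V) ^ 2 = tr (V ^ 2) = |V| ^ 2 = 1], and the trace is 1 or -1. This is the dichotomy between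
    [V > 0] and [V < 0]. *)
Lemma rank1_sphereE V :
  rank1_sphere d V <-> rank1_projector V \/ rank1_projector (- V).
Proof.
split=> [[hV /mxrank1P[V0 mV] nV]|[/rank1_projector_sphere//|]]; last first.
  by move/rank1_projector_sphere/rank1_sphereN.
have : \tr V ^+ 2 = 1.
  rewrite expr2 -mxtraceZ -minors2_eq0_sqr// -herm_sqr_mxnorm2//.
  by rewrite nV expr1n.
move/eqP; rewrite -[X in _ == X](expr1n _ 2) eqf_sqr => /orP[] /eqP tV.
  by left.
by right; split; [exact/hermN|exact/minors2_eq0N|rewrite raddfN/= tV opprK].
Qed.

Lemma rank1_projector_psd V : rank1_projector V -> psdmx V.
Proof.
move=> pV; case: (pV) => hV _ _; split => // x.
rewrite -(rank1_projector_idem pV).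
have /hermP hV' := hV.
(* With [V = V * V] and [V] hermitian, the quadratic form is the squared norm of [V x]. *)
have -> : x^t* *m (V *m V) *m x = (V *m x)^t* *m (V *m x).
  have -> : (V *m x)^t* = x^t* *m V.
    rewrite trmx_mul map_mxM/=; congr (_ *m _).
    by apply/matrixP => i j; rewrite !mxE; rewrite [RHS]hV'.
  by rewrite !mulmxA.
rewrite mxE; apply: sumr_ge0 => i _; rewrite !mxE mulrC.
exact: mul_conjC_ge0.
Qed.

Lemma psdmx_trace_ge0 V : psdmx V -> 0 <= \tr V.
Proof.
move=> [_ pV]; apply: sumr_ge0 => i _.
have := pV (delta_mx i 0); congr (0 <= _).
rewrite -mulmxA -colE mxE (bigD1 i)//= big1 ?addr0.
  by rewrite !mxE !eqxx conjC1 mul1r.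
by move=> j ji; rewrite !mxE (negbTE ji)/= conjC0 mul0r.
Qed.

Lemma rank1_projectorN_psd V : rank1_projector (- V) -> ~ psdmx V.
Proof.
move=> [_ _]; rewrite raddfN/= => tV /psdmx_trace_ge0.
by rewrite -[\tr V]opprK tV oppr_ge0 ler10.
Qed.

Lemma rank1_projector_Nprojector V : rank1_projector V -> ~ rank1_projector (- V).
Proof. by move=> /rank1_projector_psd pV /rank1_projectorN_psd. Qed.

Lemma rank1_sphere_posE : rank1_sphere_pos d = rank1_projector.
Proof.
apply/seteqP; split=> V; last first.
  by move=> pV; split; [exact: rank1_projector_sphere|exact: rank1_projector_psd].
by move=> [/rank1_sphereE[//|/rank1_projectorN_psd]].
Qed.

Lemma rank1_projector_outer (x : 'cV[R[i]]_d) :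
  sqnormC x = 1 <-> rank1_projector (x *m x^t*).
Proof.
have tE : \tr (x *m x^t*) = (sqnormC x)%:C.
  rewrite mxtrace_mulC /mxtrace big_ord1 /sqnormC mxE.
  under eq_bigr => i _ do rewrite !mxE mulrC -sqr_normc -add_Re2_Im2.
  by rewrite -rmorph_sum.
split=> [x1|[_ _]]; last by rewrite tE => /complexI.
split; last by rewrite tE x1.
  apply/hermP => i j; rewrite !mxE !big_ord1 !mxE rmorphM/= mulrC.
  by congr (_ * _); rewrite conjcK.
by move=> i j k l; rewrite !mxE !big_ord1 !mxE; ring.
Qed.

Lemma mxtrace_outer A (x : 'cV[R[i]]_d) :
  \tr (x *m x^t* *m A) = (x^t* *m A *m x) 0 0.
Proof. by rewrite -mulmxA mxtrace_mulC /mxtrace big_ord1. Qed.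

Lemma herm_trace_real A V : herm d V -> herm d A ->
  \tr (V *m A) = (complex.Re (\tr (V *m A)))%:C.
Proof.
move=> /hermP hV /hermP hA.
have : (\tr (V *m A))^*%C = \tr (V *m A).
  rewrite [in RHS]mxtrace_mulC !mxtraceM_coord rmorph_sum; apply: eq_bigr => i _.
  rewrite rmorph_sum; apply: eq_bigr => j _.
  by rewrite rmorphM/= -hV -hA mulrC.
case: (\tr _) => a b [] /eqP; rewrite eq_sym -addr_eq0 -mulr2n mulrn_eq0/=.
by move=> /eqP ->.
Qed.

Lemma rank1_projector_entry V i j : rank1_projector V -> `|V i j| <= 1.
Proof.
move=> /rank1_projector_norm; rewrite sqr_mxnorm2 => V1.
rewrite -(@expr_le1 _ 2)// -add_Re2_Im2 lecR -V1.
rewrite (bigD1 i)//= (bigD1 j)//= -addrA lerDl addr_ge0//.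
  by apply: sumr_ge0 => k _; rewrite addr_ge0// sqr_ge0.
apply: sumr_ge0 => k _; apply: sumr_ge0 => l _.
by rewrite addr_ge0// sqr_ge0.
Qed.

(** The l1 norm of the entries, a bound for [tr (V A)] that is uniform over projectors [V]. The sum
    is already real; [complex.Re] only changes its type. *)
Definition entry_sum A : R := complex.Re (\sum_i \sum_j `|A j i|).

Lemma rank1_projector_trace_bound A V : rank1_projector V ->
  `|complex.Re (\tr (V *m A))| <= entry_sum A.
Proof.
move=> pV; rewrite -lecR (le_trans (normc_ge_Re _))//.
rewrite /entry_sum RRe_real; last first.
  by apply: ger0_real; apply: sumr_ge0 => i _; apply: sumr_ge0.
rewrite mxtraceM_coord (le_trans (ler_norm_sum _ _ _))//.
apply: ler_sum => i _; rewrite (le_trans (ler_norm_sum _ _ _))//.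
by apply: ler_sum => j _; rewrite normrM ler_piMl// rank1_projector_entry.
Qed.

End rank_one_matrices.

(** * Complements on integration *)

Section integral_complements.
Local Open Scope ereal_scope.
Context d (T : measurableType d) (R : realType).
Implicit Types (mu : {measure set T -> \bar R}) (f g : T -> \bar R).
Import HBNNSimple.

(** [f] is arbitrary, so almost-everywhere lemmas for measurable functions cannot be applied to it.
    The argument takes place inside the supremum over simple functions: cutting a simple function
    below [f] off outside [E] does not change its integral. The generality serves the integrand of
    [spherical_mx_polar]. *)
Lemma ge0_integral_conegligible mu (E : set T) f :
  measurable E -> mu (~` E) = 0 -> (forall x, 0 <= f x) ->
  \int[mu]_x f x = \int[mu]_(x in E) f x.
Proof.
move=> mE E0 f0; rewrite [RHS]integral_mkcond !ge0_integralE//; last first.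
  by move=> x _; exact: erestrict_ge0.
rewrite !patch_setT; apply/eqP; rewrite eq_le; apply/andP; split; last first.
  apply: le_ereal_sup => _ [h hf <-]; exists h => // x.
  by rewrite (le_trans (hf x))//= patchE; case: ifPn.
apply: ge_ereal_sup => _ [h hf <-]; apply: ereal_sup_ubound.
have projE x : proj_nnsfun h mE x = (h x * (x \in E)%:R)%R.
  by rewrite -[RHS]/(h x * _)%R -indicE.
exists (proj_nnsfun h mE).
  move=> x; change ((proj_nnsfun h mE x)%:E <= (f \_ E) x).
  rewrite patchE projE; case: ifPn => xE.
    by rewrite mulr1.
  by rewrite mulr0.
have mk (k : {nnsfun T >-> R}) : measurable_fun setT (fun x => (k x)%:E).
  exact/measurable_EFinP.
have k0 (k : {nnsfun T >-> R}) x : setT x -> 0 <= (k x)%:E by rewrite lee_fin.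
rewrite -!integralT_nnsfun.
apply: (ge0_ae_eq_integral measurableT (mk _) (mk _) (k0 _) (k0 _)).
exists (~` E); split; [exact: measurableC|by []|].
move=> x hx Ex; apply: hx => _.
by rewrite projE mem_set// mulr1.
Qed.

Lemma ge0_eq_integral_conegligible mu (E : set T) f g :
  measurable E -> mu (~` E) = 0 ->
  (forall x, 0 <= f x) -> (forall x, 0 <= g x) -> {in E, f =1 g} ->
  \int[mu]_x f x = \int[mu]_x g x.
Proof.
move=> mE E0 f0 g0 fg.
rewrite (ge0_integral_conegligible mE E0 f0) (ge0_integral_conegligible mE E0 g0).
exact: eq_integral.
Qed.

Lemma integral_mscale mu (k : {nonneg R}) f :
  mu.-integrable setT f ->
  \int[mscale k mu]_x f x = k%:num%:E * \int[mu]_x f x.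
Proof.
move=> fi; have mf := measurable_int _ fi.
rewrite [LHS]integralE [X in _ = _ * X]integralE !ge0_integral_mscale//.
- rewrite [RHS]muleBr// fin_num_adde_defr// integrable_fin_num//.
  exact: integrable_funepos.
- exact: measurable_funeneg.
- exact: measurable_funepos.
Qed.

Lemma Rintegral_mscale mu (k : {nonneg R}) (f : T -> R) :
  mu.-integrable setT (EFin \o f) ->
  (\int[mscale k mu]_x f x = k%:num * \int[mu]_x f x)%R.
Proof.
by move=> fi; rewrite /Rintegral integral_mscale// fineM// integrable_fin_num.
Qed.

Lemma le_integrable_bound mu (f g : T -> R) :
  measurable_fun setT f -> (forall x, `|f x| <= g x)%R ->
  mu.-integrable setT (EFin \o g) -> mu.-integrable setT (EFin \o f).
Proof.
move=> mf fg; apply: le_integrable => //; first exact/measurable_EFinP.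
by move=> x _ /=; rewrite lee_fin (le_trans (fg x))// ler_norm.
Qed.

Lemma bounded_integrable (P : probability T R) (f : T -> R) (K : R) :
  measurable_fun setT f -> (forall x, `|f x| <= K)%R ->
  P.-integrable setT (EFin \o f).
Proof.
move=> mf fK; apply: (@le_integrable_bound _ _ (cst K)) => //.
exact: finite_measure_integrable_cst.
Qed.

End integral_complements.

(** * Sigma-finiteness of Levy measures *)

Section sigma_finite_levy.
Local Open Scope ereal_scope.
Context {R : realType}.
Local Notation RB := (measurableTypeR R).
Variable nu : {measure set RB -> \bar R}.
Hypotheses (nu0 : nu [set 0%R] = 0)
           (nuy : \int[nu]_x (Num.min 1 (x ^+ 2))%:E < +oo).

Lemma measurable_min1_sqr : measurable_fun setT (fun x : R => Num.min 1 (x ^+ 2))%R.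
Proof. by apply: measurable_minr. Qed.

(** Markov's inequality for [min(1, x ^ 2)]. *)
Lemma levy_tail_finite (e : R) : (0 < e)%R ->
  nu [set x : R | e <= Num.min 1 (x ^+ 2)]%R < +oo.
Proof.
move=> e0; set A := [set x | _].
have mA : measurable A.
  have -> : A = (fun x : R => Num.min 1 (x ^+ 2))%R @^-1` `[e, +oo[%classic.
    by apply/seteqP; split=> x /=; rewrite in_itv/= andbT.
  by rewrite -[X in measurable X]setTI; exact: measurable_min1_sqr.
have min0 (x : R) : (0 <= Num.min 1 (x ^+ 2))%R by rewrite le_min ler01 sqr_ge0.
have := @le_integral_comp_abse _ _ _ nu _ measurableT
  (fun x : RB => (Num.min 1 (x ^+ 2))%:E) e id _ _ _ _ e0.
rewrite setTI (_ : [set x | _] = A); last first.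
  apply/seteqP; split=> x /=; rewrite lee_fin ger0_norm//.
under eq_integral => x _ do rewrite /= ger0_norm//.
move=> H; have {}H : e%:E * nu A <= \int[nu]_x (Num.min 1 (x ^+ 2))%:E.
  by apply: H => //; apply/measurable_EFinP; exact: measurable_min1_sqr.
have : e%:E * nu A < +oo by exact: le_lt_trans H nuy.
by case: (nu A) (measure_ge0 nu A) => [r|_|//]; rewrite ?ltry// gt0_muley.
Qed.

(** The line is covered by the tails of finite mass and by the origin, which they all miss and which
    is null. *)
Lemma levy_sigma_finite : sigma_finite setT nu.
Proof.
exists (fun n => [set 0%R] `|` [set x : R | (n.+1%:R^-1 <= Num.min 1 (x ^+ 2))%R]).
  apply/esym/seteqP; split=> // x _.
  have [->|x0] := eqVneq x 0%R; first by exists 0%N => //; left.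
  have m0 : (0 < Num.min 1 (x ^+ 2))%R by rewrite lt_min ltr01 exprn_even_gt0.
  have [n] := ltr_add_invr m0; rewrite add0r => /ltW h.
  by exists n => //; right.
move=> n; have mA : measurable [set x : R | (n.+1%:R^-1 <= Num.min 1 (x ^+ 2))%R].
  have -> : [set x : R | (n.+1%:R^-1 <= Num.min 1 (x ^+ 2))%R] =
      (fun x : R => Num.min 1 (x ^+ 2))%R @^-1` `[(n.+1%:R^-1)%R, +oo[%classic.
    by apply/seteqP; split=> x /=; rewrite in_itv/= andbT.
  by rewrite -[X in measurable X]setTI; exact: measurable_min1_sqr.
split; first exact: measurableU.
rewrite (le_lt_trans (measureU2 _ _ _))//.
have nu0y : nu [set 0%R] < +oo by rewrite nu0.
by apply: lte_add_pinfty; [exact: nu0y|exact: levy_tail_finite].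
Qed.

End sigma_finite_levy.

Section pushforward_as_measure.
Context d d' (T1 : measurableType d) (T2 : measurableType d') (R : realType).
Context (m : {measure set T1 -> \bar R}) (f : T1 -> T2).

(** The measure structure of [pushforward m f] depends on a proof that [f] is measurable, which is
    therefore an argument. Ending with [Defined] keeps the values convertible to those of
    [pushforward]. *)
Definition push_measure :
  measurable_fun [set: T1] f -> {measure set T2 -> \bar R}.
Proof. pose n : {measure set T2 -> \bar R} := pushforward m f; exact n. Defined.

End pushforward_as_measure.

(** * Levy-Khintchine representation *)

Section levy_khintchine_exponent.
Context {R : realType}.
Local Notation RB := (measurableTypeR R).

Lemma measurable_kernel_re d (T : measurableType d) (f g : T -> R) :
  measurable_fun setT f -> measurable_fun setT g ->
  measurable_fun setT (fun t => kernel_re (f t) (g t)).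
Proof.
move=> mf mg; apply: measurable_funB => //.
apply: (measurableT_comp (continuous_measurable_fun (@continuous_cos R))).
exact: measurable_funM.
Qed.

Lemma measurable_kernel_im d (T : measurableType d) (f g : T -> R) :
  measurable_fun setT f -> measurable_fun setT g ->
  measurable_fun setT (fun t => kernel_im (f t) (g t)).
Proof.
move=> mf mg; apply: measurable_funB => //.
  apply: (measurableT_comp (continuous_measurable_fun (@continuous_sin R))).
  exact: measurable_funM.
apply: measurable_funM; first exact: measurable_funM.
have mh : measurable_fun setT (fun x : R => (1 + x ^+ 2)^-1).
  by apply: continuous_measurable_fun; exact: continuous_oneDsqrV.
exact: (measurableT_comp mh mg).
Qed.

Variable nu : {measure set RB -> \bar R}.
Hypothesis nuy : (\int[nu]_x (Num.min 1 (x ^+ 2))%:E < +oo)%E.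

Lemma integrable_min1_sqr (K : R) :
  nu.-integrable setT (EFin \o (fun x : RB => K * Num.min 1 (x ^+ 2))).
Proof.
have -> : EFin \o (fun x : RB => K * Num.min 1 (x ^+ 2)) =
    (fun x : RB => K%:E * (Num.min 1 (x ^+ 2))%:E)%E.
  by apply/funext => x /=; rewrite EFinM.
apply: integrableZl => //; apply/integrableP; split.
  by apply/measurable_EFinP; exact: measurable_min1_sqr.
under eq_integral => x _ do rewrite /= ger0_norm ?le_min ?ler01 ?sqr_ge0//.
exact: nuy.
Qed.

Lemma integrable_kernel_im z : nu.-integrable setT (EFin \o kernel_im z).
Proof.
apply: le_integrable_bound (integrable_min1_sqr (kernel_bound z)).
  exact: measurable_kernel_im.
exact: kernel_im_bound.
Qed.

(** Dominated convergence on []z - 1, z + 1[], where [kernel_bound (|z| + 1)] majorizes all the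
    constants. *)
Lemma continuous_integral_kernel (k : R -> R -> R) :
  (forall z, nu.-integrable setT (EFin \o k z)) ->
  (forall z x, `|k z x| <= kernel_bound z * Num.min 1 (x ^+ 2)) ->
  (forall x, continuous (k ^~ x)) ->
  continuous (fun z => \int[nu]_x k z x).
Proof.
move=> ki kb kc z.
have zI : z \in `]z - 1, z + 1[%classic.
  by rewrite inE /= in_itv/= ltrBlDr ltrDl ltr01.
apply: (@continuity_under_integral _ _ _ nu k setT measurableT (z - 1) (z + 1)
  _ _ (fun x : RB => kernel_bound (`|z| + 1) * Num.min 1 (x ^+ 2)) _ _ z zI).
- by [].
- by apply: nearW => x _ y _; exact: kc.
- exact: integrable_min1_sqr.
- move=> y; rewrite /= in_itv/= => /andP[zy yz]; apply: nearW => x _.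
  rewrite (le_trans (kb _ _))// ler_wpM2r// ?le_min ?ler01 ?sqr_ge0//.
  apply: le_kernel_bound; have := ler_norm z; have := ler_norm (- z).
  by rewrite normrN ler_norml; lra.
Qed.

Lemma cintegral_levy_kernel z :
  cintegral nu (fun x : RB => cexp ('i * (z * x)%:C) - 1
                      - 'i * (z * x / (1 + x ^+ 2))%:C) =
  (\int[nu]_x kernel_re z x) +i* (\int[nu]_x kernel_im z x).
Proof.
by rewrite /cintegral; congr (_ +i* _); apply: eq_Rintegral => x _;
  rewrite levy_kernelE.
Qed.

Lemma cumulant_transform_levy (mu : probability RB R) (C : R -> R[i]) (gamma a : R) :
  is_cumulant_transform mu C ->
  (forall z : R, charfun mu z =
     cexp ('i * (gamma * z)%:C - (a * z ^+ 2 / 2)%:C +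
           cintegral nu (fun x : RB => cexp ('i * (z * x)%:C) - 1
                              - 'i * (z * x / (1 + x ^+ 2))%:C))) ->
  forall z, C z = (- (a * z ^+ 2 / 2) + \int[nu]_x kernel_re z x) +i*
                  (gamma * z + \int[nu]_x kernel_im z x).
Proof.
move=> [cC C0 CE] muE.
pose E z := (- (a * z ^+ 2 / 2) + \int[nu]_x kernel_re z x) +i*
            (gamma * z + \int[nu]_x kernel_im z x).
have CEE z : cexp (C z) = cexp (E z).
  rewrite -CE muE; congr cexp; rewrite cintegral_levy_kernel.
  by apply/eqP; rewrite eq_complex /= !mul0r !mul1r !subrr !add0r subr0 !eqxx.
(* The real parts agree pointwise, through the moduli. Continuity is brought in for the imaginary
   parts, known so far modulo 2 pi. *)
move=> z; rewrite -/(E z); apply/eqP; rewrite eq_complex (cexp_eq_Re (CEE z)) eqxx.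
rewrite -subr_eq0; apply/eqP.
apply: (@continuous_cos_eq1 _ (fun z => complex.Im (C z) - complex.Im (E z))).
- move=> {}z; apply: cvgB.
    apply: (@cvg_comp _ _ _ C (@complex.Im R)); first exact: cC.
    exact: continuous_Im.
  apply: cvgD; first exact: mulrl_continuous.
  apply: continuous_integral_kernel.
  + exact: integrable_kernel_im.
  + exact: kernel_im_bound.
  + exact: continuous_kernel_im.
- rewrite C0 /= mulr0 !add0r; apply/eqP; rewrite oppr_eq0; apply/eqP.
  rewrite /Rintegral integral0_eq// => x _.
  by rewrite /kernel_im !mul0r sin0 subrr.
- by move=> {}z; apply: cexp_eq_Im.
Qed.

End levy_khintchine_exponent.

(** * Fubini for kernels dominated by [min(1, x ^ 2)] *)

Section fubini_kernel.
Context d (T : measurableType d) (R : realType).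
Local Notation RB := (measurableTypeR R).
Variables (P : probability T R) (nu : {sigma_finite_measure set RB -> \bar R}).
Hypothesis nuy : (\int[nu]_x (Num.min 1 (x ^+ 2))%:E < +oo)%E.
Variables (k : T -> R -> R) (K : R).
Hypothesis mk : measurable_fun setT (fun wx : T * RB => k wx.1 wx.2).
Hypothesis kK : forall w x, `|k w x| <= K * Num.min 1 (x ^+ 2).

(** The majorant does not depend on [w] and [P] has mass 1, so by Tonelli its integral over the
    product is its integral against [nu]. *)
Lemma integrable_prod_kernel :
  (P \x nu)%E.-integrable setT (EFin \o (fun wx : T * RB => k wx.1 wx.2)).
Proof.
apply: (@le_integrable_bound _ _ _ _ _
    (fun wx : T * RB => K * Num.min 1 (wx.2 ^+ 2))) => //.
have mg : measurable_fun setT (fun wx : T * RB => (K * Num.min 1 (wx.2 ^+ 2))%:E).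
  apply/measurable_EFinP; apply: measurable_funM => //.
  exact: (measurableT_comp measurable_min1_sqr).
apply/integrable12ltyP => //.
have := integrable_min1_sqr nuy K => /integrableP[_ Ky].
pose I := (\int[nu]_x `|(K * Num.min 1 (x ^+ 2))%:E|)%E.
change (\int[P]_w cst I w < +oo)%E.
rewrite (integral_cst P measurableT) [X in (_ * X)%E](probability_setT P) mule1.
exact: Ky.
Qed.

Let F_fin w : (\int[nu]_x (k w x)%:E = (\int[nu]_x k w x)%R%:E)%E.
Proof.
rewrite fineK// integrable_fin_num//.
apply: le_integrable_bound (integrable_min1_sqr nuy K); last exact: kK.
exact: (measurableT_comp mk (measurable_pair1 w)).
Qed.

Lemma integrable_kernel_partial :
  P.-integrable setT (EFin \o (fun w => \int[nu]_x k w x)).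
Proof.
have := integrable_fubini_F integrable_prod_kernel.
by apply: eq_integrable => // w _; rewrite /= -F_fin.
Qed.

Lemma Rintegral_prod_kernel :
  \int[(P \x nu)%E]_wx k wx.1 wx.2 = \int[P]_w \int[nu]_x k w x.
Proof.
rewrite /Rintegral -(integral12_prod_meas1 integrable_prod_kernel).
by congr fine; apply: eq_integral => w _; rewrite /= -F_fin.
Qed.

End fubini_kernel.

Section conegligible_integral.
Local Open Scope ereal_scope.

(** Positive and negative parts reduce this to the nonnegative case, so [f] and [g] are again
    arbitrary functions. *)
Lemma eq_integral_conegligible d (T : measurableType d) (R : realType)
    (mu : {measure set T -> \bar R}) (E : set T) (f g : T -> \bar R) :
  measurable E -> mu (~` E) = 0 -> {in E, f =1 g} ->
  \int[mu]_x f x = \int[mu]_x g x.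
Proof.
move=> mE E0 fg; rewrite [LHS]integralE [RHS]integralE.
by congr (_ - _); apply: (ge0_eq_integral_conegligible mE E0) => // x xE;
  rewrite ?funeposE ?funenegE fg.
Qed.

End conegligible_integral.

Section matrix_measurable_functions.
Context {R : realType}.
Variable n : nat.
Implicit Types A Y : 'M[R[i]]_n.

Lemma Re_mxtraceM Y A : complex.Re (\tr (Y *m A)) =
  \sum_i \sum_j (complex.Re (Y i j) * complex.Re (A j i) -
                 complex.Im (Y i j) * complex.Im (A j i)).
Proof.
rewrite mxtraceM_coord raddf_sum; apply: eq_bigr => i _.
by rewrite raddf_sum; apply: eq_bigr => j _; case: (Y i j) (A j i) => ? ? [].
Qed.

Lemma Im_mxtraceM Y A : complex.Im (\tr (Y *m A)) =
  \sum_i \sum_j (complex.Re (Y i j) * complex.Im (A j i) +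
                 complex.Im (Y i j) * complex.Re (A j i)).
Proof.
rewrite mxtraceM_coord raddf_sum; apply: eq_bigr => i _.
by rewrite raddf_sum; apply: eq_bigr => j _; case: (Y i j) (A j i) => ? ? [].
Qed.

Lemma measurable_Re_entry i j :
  measurable_fun [set: 'M[R[i]]_n] (fun Y : 'M[R[i]]_n => complex.Re (Y i j)).
Proof. exact: (measurable_coord_continuous i j continuous_Re). Qed.

Lemma measurable_Im_entry i j :
  measurable_fun [set: 'M[R[i]]_n] (fun Y : 'M[R[i]]_n => complex.Im (Y i j)).
Proof. exact: (measurable_coord_continuous i j continuous_Im). Qed.

Lemma measurable_Re_mxtraceM A :
  measurable_fun [set: 'M[R[i]]_n] (fun Y : 'M[R[i]]_n => complex.Re (\tr (Y *m A))).
Proof.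
under eq_fun do rewrite Re_mxtraceM.
apply: measurable_sum => i; apply: measurable_sum => j.
apply: measurable_funB; apply: measurable_funM => //.
  exact: measurable_Re_entry.
exact: measurable_Im_entry.
Qed.

Lemma measurable_Im_mxtraceM A :
  measurable_fun [set: 'M[R[i]]_n] (fun Y : 'M[R[i]]_n => complex.Im (\tr (Y *m A))).
Proof.
under eq_fun do rewrite Im_mxtraceM.
apply: measurable_sum => i; apply: measurable_sum => j.
apply: measurable_funD; apply: measurable_funM => //.
  exact: measurable_Re_entry.
exact: measurable_Im_entry.
Qed.

Lemma measurable_sqr_mxnorm2 :
  measurable_fun [set: 'M[R[i]]_n] (fun Y : 'M[R[i]]_n => mxnorm2 Y ^+ 2).
Proof.
under eq_fun do rewrite sqr_mxnorm2.
apply: measurable_sum => i; apply: measurable_sum => j.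
apply: measurable_funD; apply: measurable_funX.
  exact: measurable_Re_entry.
exact: measurable_Im_entry.
Qed.

Lemma Re_mulRc (r : R) (z : R[i]) : complex.Re (r%:C * z) = r * complex.Re z.
Proof. by case: z => a b /=; rewrite mul0r subr0. Qed.

Lemma Im_mulRc (r : R) (z : R[i]) : complex.Im (r%:C * z) = r * complex.Im z.
Proof. by case: z => a b /=; rewrite mul0r addr0. Qed.

Lemma Re_mxtraceZ (r : R) Y A :
  complex.Re (\tr ((r%:C *: Y) *m A)) = r * complex.Re (\tr (Y *m A)).
Proof. by rewrite -scalemxAl mxtraceZ Re_mulRc. Qed.

Lemma Re_mxtrace_linear (r : R) Y A B :
  complex.Re (\tr (Y *m (r%:C *: A + B))) =
  r * complex.Re (\tr (Y *m A)) + complex.Re (\tr (Y *m B)).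
Proof. by rewrite mulmxDr -scalemxAr mxtraceD mxtraceZ raddfD /= Re_mulRc. Qed.

Lemma sqr_mxnorm2Z (r : R) Y : mxnorm2 (r%:C *: Y) ^+ 2 = r ^+ 2 * mxnorm2 Y ^+ 2.
Proof.
rewrite !sqr_mxnorm2 mulr_sumr; apply: eq_bigr => i _.
rewrite mulr_sumr; apply: eq_bigr => j _.
by rewrite !mxE Re_mulRc Im_mulRc !exprMn mulrDr.
Qed.

End matrix_measurable_functions.

(** * The Levy measure of the matrix as an image of a product measure *)

Section random_projector.
Context d (T : measurableType d) (R : realType) (n : nat).
Local Notation RB := (measurableTypeR R).
Variables (P : probability T R) (nu : {sigma_finite_measure set RB -> \bar R}).
Hypothesis nu0 : nu [set 0] = 0%E.
Hypothesis nuy : (\int[nu]_x (Num.min 1 (x ^+ 2))%:E < +oo)%E.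
Variable V : T -> 'M[R[i]]_n.
Hypothesis mV : measurable_fun setT V.
Hypothesis pV : forall w, rank1_projector (V w).

Let q A w : R := complex.Re (\tr (V w *m A)).

Let mq A : measurable_fun setT (q A).
Proof. exact: (measurableT_comp (measurable_Re_mxtraceM A) mV). Qed.

Let qb A w : `|q A w| <= entry_sum A.
Proof. exact: rank1_projector_trace_bound. Qed.

Let hV w : herm n (V w). Proof. by case: (pV w). Qed.

Definition scaled_projector (wx : T * RB) : 'M[R[i]]_n := wx.2%:C *: V wx.1.

Lemma measurable_scaled_projector : measurable_fun setT scaled_projector.
Proof.
apply: measurable_fun_mx => i j; rewrite /scaled_projector.
  under eq_fun do rewrite mxE Re_mulRc.
  apply: measurable_funM => //.
  exact: (measurableT_comp (measurable_fun_coord i j mV continuous_Re)).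
under eq_fun do rewrite mxE Im_mulRc.
apply: measurable_funM => //.
exact: (measurableT_comp (measurable_fun_coord i j mV continuous_Im)).
Qed.

Definition levy_mx : {measure set 'M[R[i]]_n -> \bar R} :=
  mscale n%:R%:nng (push_measure (P \x nu)%E measurable_scaled_projector).

Lemma levy_mxE B : levy_mx B =
  (n%:R%:E * (P \x nu) (scaled_projector @^-1` B))%E.
Proof. by []. Qed.

(** [x V] is always hermitian, and it vanishes only for [x = 0] because [V] has trace 1. The bad
    event is thus contained in [x = 0], which [nu] does not charge. *)
Lemma levy_mx_support : levy_mx (~` (herm n `\ 0)) = 0%E.
Proof.
rewrite levy_mxE (_ : _ @^-1` _ = setT `*` [set 0]).
  by rewrite product_measure1E// [X in (_ * (_ * X))%E]nu0 !mule0.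
apply/seteqP; split=> [[w x] /= Bx|[w x] [_ /= ->]].
  split => //=; apply: contrapT => x0; apply: Bx; split; first exact: hermZ.
  move=> /= /eqP; rewrite scaler_eq0 => /orP[/eqP/complexI //|/eqP V0].
  have [_ _] := pV w; rewrite V0 mxtrace0 => /esym/eqP.
  by rewrite oner_eq0.
by rewrite /scaled_projector /= scale0r => -[_]; apply.
Qed.

Lemma sqr_mxnorm2_scaled_projector wx :
  mxnorm2 (scaled_projector wx) ^+ 2 = wx.2 ^+ 2.
Proof. by rewrite sqr_mxnorm2Z rank1_projector_norm// mulr1. Qed.

Lemma levy_mx_integrability :
  (\int[levy_mx]_Y (Num.min 1 (mxnorm2 Y ^+ 2))%:E < +oo)%E.
Proof.
have mm : measurable_fun [set: 'M[R[i]]_n]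
    (fun Y => (Num.min 1 (mxnorm2 Y ^+ 2))%:E).
  by apply/measurable_EFinP; apply: measurable_minr => //; exact: measurable_sqr_mxnorm2.
have m0 (Y : 'M[R[i]]_n) : (0 <= (Num.min 1 (mxnorm2 Y ^+ 2))%:E)%E.
  by rewrite lee_fin le_min ler01 sqr_ge0.
rewrite ge0_integral_mscale//.
rewrite (ge0_integral_pushforward measurable_scaled_projector)//.
have bound (w : T) (x : R) : `|Num.min 1 (x ^+ 2)| <= 1 * Num.min 1 (x ^+ 2).
  by rewrite mul1r ger0_norm// le_min ler01 sqr_ge0.
have /integrableP[_] := @integrable_prod_kernel _ _ _ P nu nuy
  (fun=> fun x => Num.min 1 (x ^+ 2)) 1
  (measurableT_comp measurable_min1_sqr measurable_snd) bound.
move=> h; rewrite lte_mul_pinfty// ?lee_fin//.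
apply: le_lt_trans h.
rewrite le_eqVlt; apply/orP; left; apply/eqP; apply: eq_integral => wx _ /=.
by rewrite sqr_mxnorm2_scaled_projector ger0_norm// le_min ler01 sqr_ge0.
Qed.

(** [k] is [g] read in the coordinates [(w, x)]. Its domination justifies both the change of
    variables and Fubini. *)
Lemma Rintegral_levy_mx (g : 'M[R[i]]_n -> R) (k : T -> R -> R) (K : R) :
  measurable_fun setT g -> measurable_fun setT (fun wx : T * RB => k wx.1 wx.2) ->
  (forall w x, `|k w x| <= K * Num.min 1 (x ^+ 2)) ->
  (forall w x, g (x%:C *: V w) = k w x) ->
  \int[levy_mx]_Y g Y = n%:R * \int[P]_w \int[nu]_x k w x.
Proof.
move=> mg mk kK gk.
have ki := integrable_prod_kernel P nuy mk kK.
have gE : (EFin \o g) \o scaled_projector = EFin \o (fun wx : T * RB => k wx.1 wx.2).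
  by apply/funext => -[w x] /=; rewrite -gk.
have gi : (P \x nu)%E.-integrable (scaled_projector @^-1` setT)
    ((EFin \o g) \o scaled_projector) by rewrite gE.
have mg' : measurable_fun setT (EFin \o g) by exact/measurable_EFinP.
rewrite Rintegral_mscale; last first.
  exact: (integrable_pushforward measurable_scaled_projector mg' gi).
rewrite -(Rintegral_prod_kernel P nuy mk kK); congr (_ * fine _).
rewrite [LHS](integral_pushforward measurable_scaled_projector mg' gi)//.
rewrite preimage_setT; apply: eq_integral => wx _.
by rewrite -[LHS]/(((EFin \o g) \o scaled_projector) wx) gE.
Qed.

End random_projector.

Lemma normc_ge_Im (R : rcfType) (z : R[i]) : `|complex.Im z|%:C <= `|z|.
Proof.
rewrite normc_def lecR -(sqrtr_sqr (complex.Im z)) ler_wsqrtr// lerDr.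
exact: sqr_ge0.
Qed.

Lemma Rintegral_sum d (T : measurableType d) (R : realType)
    (mu : {measure set T -> \bar R}) (I : Type) (s : seq I) (f : I -> T -> R) :
  (forall i, mu.-integrable setT (EFin \o f i)) ->
  \int[mu]_x (\sum_(i <- s) f i x) = \sum_(i <- s) \int[mu]_x f i x.
Proof.
move=> fi; rewrite /Rintegral.
under eq_integral => x _ do rewrite -sumEFin.
rewrite (integral_sum measurableT fi) sum_fine// => i _.
exact: (integrable_fin_num measurableT (fi i)).
Qed.

Section integrable_EFin.
Context d (T : measurableType d) (R : realType) (mu : {measure set T -> \bar R}).
Implicit Types (f g : T -> R) (k : R).

Lemma integrableZl_EFin k f : mu.-integrable setT (EFin \o f) ->
  mu.-integrable setT (EFin \o (fun x => k * f x)).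
Proof.
have -> : EFin \o (fun x => k * f x) = (fun x => k%:E * (EFin \o f) x)%E.
  by apply/funext => x /=; rewrite EFinM.
exact: integrableZl.
Qed.

Lemma integrableZr_EFin k f : mu.-integrable setT (EFin \o f) ->
  mu.-integrable setT (EFin \o (fun x => f x * k)).
Proof. by under eq_fun do rewrite mulrC; exact: integrableZl_EFin. Qed.

Lemma integrableB_EFin f g : mu.-integrable setT (EFin \o f) ->
  mu.-integrable setT (EFin \o g) ->
  mu.-integrable setT (EFin \o (fun x => f x - g x)).
Proof.
have -> : EFin \o (fun x => f x - g x) = ((EFin \o f) \- (EFin \o g))%E.
  by apply/funext => x /=; rewrite EFinB.
exact: integrableB.
Qed.

Lemma integrable_sum_EFin (I : Type) (s : seq I) (f : I -> T -> R) :
  (forall i, mu.-integrable setT (EFin \o f i)) ->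
  mu.-integrable setT (EFin \o (fun x => \sum_(i <- s) f i x)).
Proof.
have -> : EFin \o (fun x => \sum_(i <- s) f i x) =
    (fun x => \sum_(i <- s) (EFin \o f i) x)%E.
  by apply/funext => x /=; rewrite sumEFin.
by move=> fi; apply: integrable_sum.
Qed.

End integrable_EFin.

(** * The Levy-Khintchine exponent on hermitian matrices *)

Section levy_khintchine_mx.
Context d (T : measurableType d) (R : realType) (n : nat).
Local Notation RB := (measurableTypeR R).
Variables (P : probability T R) (nu : {sigma_finite_measure set RB -> \bar R}).
Hypothesis nuy : (\int[nu]_x (Num.min 1 (x ^+ 2))%:E < +oo)%E.
Variable V : T -> 'M[R[i]]_n.
Hypothesis mV : measurable_fun setT V.
Hypothesis pV : forall w, rank1_projector (V w).

Let q A w : R := complex.Re (\tr (V w *m A)).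

Let mq A : measurable_fun setT (q A).
Proof. exact: (measurableT_comp (measurable_Re_mxtraceM A) mV). Qed.

Let qb A w : `|q A w| <= entry_sum A.
Proof. exact: rank1_projector_trace_bound. Qed.

Let hV w : herm n (V w). Proof. by case: (pV w). Qed.

Let kernel_unif (k : R -> R -> R) :
  (forall z x, `|k z x| <= kernel_bound z * Num.min 1 (x ^+ 2)) ->
  forall A w x, `|k (q A w) x| <= kernel_bound (entry_sum A) * Num.min 1 (x ^+ 2).
Proof.
move=> kb A w x; rewrite (le_trans (kb _ _))// ler_wpM2r//.
  by rewrite le_min ler01 sqr_ge0.
exact: le_kernel_bound.
Qed.

Let mkre A : measurable_fun setT (fun wx : T * RB => kernel_re (q A wx.1) wx.2).
Proof. exact: (measurable_kernel_re (measurableT_comp (mq A) measurable_fst)). Qed.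

Let mkim A : measurable_fun setT (fun wx : T * RB => kernel_im (q A wx.1) wx.2).
Proof. exact: (measurable_kernel_im (measurableT_comp (mq A) measurable_fst)). Qed.

Local Notation nuV := (levy_mx P nu mV).

Lemma cintegral_levy_mx A : herm n A ->
  cintegral nuV (fun Y => cexp ('i * \tr (Y *m A)) - 1
                  - 'i * (\tr (Y *m A) / (1 + mxnorm2 Y ^+ 2)%:C)) =
  (n%:R * \int[P]_w \int[nu]_x kernel_re (q A w) x) +i*
  (n%:R * \int[P]_w \int[nu]_x kernel_im (q A w) x).
Proof.
move=> hA; pose t (Y : 'M[R[i]]_n) : R := complex.Re (\tr (Y *m A)).
(* [tr (Y A)] need not be real for an arbitrary complex [Y]. On this set of full measure the
   integrand takes the form of the scalar kernel. *)
pose E := [set Y : 'M[R[i]]_n | complex.Im (\tr (Y *m A)) = 0].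
have mE : measurable E.
  have -> : E = (fun Y : 'M[R[i]]_n => complex.Im (\tr (Y *m A))) @^-1` [set 0] by [].
  rewrite -[X in measurable X]setTI; apply: measurable_Im_mxtraceM => //.
have E0 : nuV (~` E) = 0%E.
  rewrite levy_mxE (_ : _ @^-1` _ = set0) ?measure0 ?mule0//.
  apply/seteqP; split=> [[w x] /=|//]; apply.
  by rewrite /E /= (herm_trace_real (hermZ x (hV w)) hA).
have GE Y : E Y -> cexp ('i * \tr (Y *m A)) - 1
      - 'i * (\tr (Y *m A) / (1 + mxnorm2 Y ^+ 2)%:C) =
    (cos (t Y) - 1) +i* (sin (t Y) - t Y / (1 + mxnorm2 Y ^+ 2)).
  rewrite /E /=; have -> : \tr (Y *m A) = t Y +i* complex.Im (\tr (Y *m A)).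
    by rewrite /t; case: (\tr _).
  move=> /= ->; rewrite -[t Y +i* 0]/((t Y)%:C) -fmorph_div/= cexp_imaginary.
  by apply/eqP; rewrite eq_complex /= !mul0r !mul1r !subr0 add0r !eqxx.
have mt : measurable_fun setT t := measurable_Re_mxtraceM A.
have mN : measurable_fun [set: 'M[R[i]]_n] (fun Y => (1 + mxnorm2 Y ^+ 2)^-1).
  have -> : (fun Y : 'M[R[i]]_n => (1 + mxnorm2 Y ^+ 2)^-1) =
      (fun x : R => (1 + x ^+ 2)^-1) \o (fun Y => mxnorm2 Y) by [].
  apply: measurableT_comp.
    by apply: continuous_measurable_fun; exact: continuous_oneDsqrV.
  have -> : @mxnorm2 R n = Num.sqrt \o (fun Y => mxnorm2 Y ^+ 2).
    by apply/funext => Y /=; rewrite sqrtr_sqr ger0_norm// mxnorm2_ge0.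
  exact: (measurableT_comp (continuous_measurable_fun (@sqrt_continuous R))
            (@measurable_sqr_mxnorm2 R n)).
rewrite /cintegral; congr (_ +i* _).
- transitivity (\int[nuV]_Y (cos (t Y) - 1)).
    congr fine; apply: (eq_integral_conegligible mE E0) => Y /set_mem YE.
    by rewrite GE.
  apply: (Rintegral_levy_mx P nuy mV _ (mkre A) (kernel_unif kernel_re_bound A)).
    apply: measurable_funB => //.
    exact: (measurableT_comp (continuous_measurable_fun (@continuous_cos R))).
  by move=> w x; rewrite /t Re_mxtraceZ mulrC.
- transitivity (\int[nuV]_Y (sin (t Y) - t Y / (1 + mxnorm2 Y ^+ 2))).
    congr fine; apply: (eq_integral_conegligible mE E0) => Y /set_mem YE.
    by rewrite GE.
  apply: (Rintegral_levy_mx P nuy mV _ (mkim A) (kernel_unif kernel_im_bound A)).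
    apply: measurable_funB; last exact: measurable_funM.
    exact: (measurableT_comp (continuous_measurable_fun (@continuous_sin R))).
  move=> w x; rewrite /t Re_mxtraceZ sqr_mxnorm2Z rank1_projector_norm// mulr1.
  by rewrite /kernel_im -/(q A w) [x * _]mulrC.
Qed.

Let iRe i j : P.-integrable setT (EFin \o (fun w => complex.Re (V w i j))).
Proof.
apply: (@bounded_integrable _ _ _ _ _ 1).
  exact: (measurable_fun_coord i j mV continuous_Re).
move=> w; rewrite -lecR (le_trans (normc_ge_Re _))//.
exact: rank1_projector_entry.
Qed.

Let iIm i j : P.-integrable setT (EFin \o (fun w => complex.Im (V w i j))).
Proof.
apply: (@bounded_integrable _ _ _ _ _ 1).
  exact: (measurable_fun_coord i j mV continuous_Im).
move=> w; rewrite -lecR (le_trans (normc_ge_Im _))//.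
exact: rank1_projector_entry.
Qed.

Variables (C : R -> R[i]) (gamma a : R).
Hypothesis a0 : 0 <= a.
Hypothesis CE : forall z, C z =
  (- (a * z ^+ 2 / 2) + \int[nu]_x kernel_re z x) +i*
  (gamma * z + \int[nu]_x kernel_im z x).

(** The drift [n * gamma * E V], obtained by integrating [gamma * z] at [z = tr (V A)]. It carries
    no correction term: [|x V| = |x|] makes the truncations on the line and on matrices agree. *)
Definition levy_drift_mx : 'M[R[i]]_n := \matrix_(i, j)
  ((n%:R * gamma * \int[P]_w complex.Re (V w i j)) +i*
   (n%:R * gamma * \int[P]_w complex.Im (V w i j))).

(** The polar form of the quadratic form left by the Gaussian term [a * z ^ 2] at [z = tr (V A)]. *)
Definition levy_cov_mx (A B : 'M[R[i]]_n) : R :=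
  n%:R * a * \int[P]_w (complex.Re (\tr (V w *m A)) * complex.Re (\tr (V w *m B))).

Lemma levy_drift_mx_herm : herm n levy_drift_mx.
Proof.
apply/hermP => i j; rewrite !mxE /=; congr (_ +i* _).
  by congr (_ * _); apply: eq_Rintegral => w _; have /hermP -> := hV w; case: (V w j i).
rewrite -mulrN; congr (_ * _).
rewrite -mulN1r -RintegralZl//; apply: eq_Rintegral => w _.
by have /hermP -> := hV w; rewrite mulN1r; case: (V w j i).
Qed.

Let iq A : P.-integrable setT (EFin \o q A).
Proof. exact: bounded_integrable (mq A) (qb A). Qed.

Let iqq A B : P.-integrable setT (EFin \o (fun w => q A w * q B w)).
Proof.
apply: (@bounded_integrable _ _ _ _ _ (entry_sum A * entry_sum B)).
  exact: measurable_funM.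
by move=> w; rewrite normrM ler_pM.
Qed.

Lemma levy_drift_mx_trace A : herm n A ->
  \tr (levy_drift_mx *m A) = (n%:R * gamma * \int[P]_w q A w)%:C.
Proof.
move=> hA; rewrite (herm_trace_real levy_drift_mx_herm hA); congr (_%:C).
rewrite Re_mxtraceM.
have iReZ i j : P.-integrable setT
    (EFin \o (fun w => complex.Re (V w i j) * complex.Re (A j i))).
  exact: integrableZr_EFin (iRe i j).
have iImZ i j : P.-integrable setT
    (EFin \o (fun w => complex.Im (V w i j) * complex.Im (A j i))).
  exact: integrableZr_EFin (iIm i j).
have iZ i j : P.-integrable setT (EFin \o (fun w =>
    complex.Re (V w i j) * complex.Re (A j i) -
    complex.Im (V w i j) * complex.Im (A j i))).
  exact: integrableB_EFin (iReZ i j) (iImZ i j).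
under eq_Rintegral => w _ do rewrite /q Re_mxtraceM.
have -> : \int[P]_w (\sum_i \sum_j (complex.Re (V w i j) * complex.Re (A j i) -
    complex.Im (V w i j) * complex.Im (A j i))) =
  \sum_i \sum_j ((\int[P]_w complex.Re (V w i j)) * complex.Re (A j i) -
    (\int[P]_w complex.Im (V w i j)) * complex.Im (A j i)).
  rewrite Rintegral_sum => [|i]; last first.
    by apply: integrable_sum_EFin => j; exact: iZ.
  apply: eq_bigr => i _; rewrite Rintegral_sum; last exact: iZ.
  apply: eq_bigr => j _; rewrite RintegralB//; first by rewrite !RintegralZr.
rewrite mulr_sumr; apply: eq_bigr => i _; rewrite mulr_sumr; apply: eq_bigr => j _.
by rewrite !mxE /=; ring.
Qed.

Lemma levy_cov_mx_form : covariance_form levy_cov_mx.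
Proof.
split=> [r A B D _ _ _|A B _ _|A _].
- rewrite /levy_cov_mx.
  under eq_Rintegral => w _ do rewrite Re_mxtrace_linear mulrDl -mulrA.
  rewrite RintegralD//; last 2 first.
  + exact: integrableZl_EFin (iqq _ _).
  + exact: iqq.
  rewrite RintegralZl//; last exact: iqq.
  by ring.
- by congr (_ * _); apply: eq_Rintegral => w _; rewrite mulrC.
- rewrite /levy_cov_mx !mulr_ge0//.
  by apply: Rintegral_ge0 => w _; rewrite -expr2 sqr_ge0.
Qed.

Lemma levy_exponent_mx A : herm n A ->
  n%:R * cintegral P (fun w => C (q A w)) =
  'i * \tr (levy_drift_mx *m A) - (levy_cov_mx A A / 2)%:C +
  cintegral nuV (fun Y => cexp ('i * \tr (Y *m A)) - 1
                  - 'i * (\tr (Y *m A) / (1 + mxnorm2 Y ^+ 2)%:C)).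
Proof.
move=> hA; rewrite cintegral_levy_mx// levy_drift_mx_trace//.
have ire := integrable_kernel_partial P nuy (mkre A) (kernel_unif kernel_re_bound A).
have iim := integrable_kernel_partial P nuy (mkim A) (kernel_unif kernel_im_bound A).
have -> : cintegral P (fun w => C (q A w)) =
    (- (a / 2) * \int[P]_w (q A w * q A w) +
      \int[P]_w \int[nu]_x kernel_re (q A w) x) +i*
    (gamma * \int[P]_w q A w + \int[P]_w \int[nu]_x kernel_im (q A w) x).
  rewrite /cintegral; congr (_ +i* _).
    under eq_Rintegral => w _ do rewrite CE /= expr2 mulrAC -mulNr.
    rewrite RintegralD//; first by rewrite RintegralZl.
    exact: integrableZl_EFin (iqq _ _).
  under eq_Rintegral => w _ do rewrite CE /=.
  rewrite RintegralD//; first by rewrite RintegralZl.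
  exact: integrableZl_EFin (iq _).
have -> : n%:R = (n%:R : R)%:C :> R[i] by rewrite rmorph_nat.
rewrite /levy_cov_mx; apply/eqP; rewrite eq_complex /=; apply/andP; split; apply/eqP.
  by field.
by ring.
Qed.

End levy_khintchine_mx.

(** * Polar decomposition *)

Section polar_decomposition.
Context {R : realType}.
Local Notation RB := (measurableTypeR R).
Local Open Scope ereal_scope.

Lemma measurable_fun_set1 (a : R) (F : R -> \bar R) :
  measurable_fun ([set a] : set RB) F.
Proof.
move=> _ B _; have [Ba|Ba] := pselect (B (F a)).
  rewrite (_ : _ `&` _ = [set a]); first exact: measurable_set1.
  by apply/seteqP; split=> x /= => [[]|->].
rewrite (_ : _ `&` _ = set0); first exact: measurable0.
by apply/seteqP; split=> x //= [->].
Qed.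

(** [F] is arbitrary because every function is measurable on a singleton. *)
Lemma ge0_integral_pm1 (lambda : {measure set RB -> \bar R}) (F : R -> \bar R) :
  (forall x, 0 <= F x) ->
  \int[lambda]_(xi in [set (-1)%R; 1%R]) F xi =
  F (-1)%R * lambda [set (-1)%R] + F 1%R * lambda [set 1%R].
Proof.
move=> F0; rewrite ge0_integral_setU//; last 2 first.
- by apply/measurable_funU => //; split; exact: measurable_fun_set1.
- apply/disj_setPLR => x /= -> /eqP; rewrite -subr_eq0 -opprD oppr_eq0.
  by rewrite -mulr2n pnatr_eq0.
have int1 (a : R) : \int[lambda]_(xi in [set a]) F xi = F a * lambda [set a].
  rewrite (@eq_integral _ _ _ _ _ (cst (F a))); last by move=> x /[!inE] ->.
  exact: integral_cst.
by rewrite !int1.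
Qed.

Variables (nu lambda : {measure set RB -> \bar R})
          (nu_ : R -> {measure set RB -> \bar R}).
Hypothesis nuy : \int[nu]_x (Num.min 1 (x ^+ 2))%:E < +oo.
Hypothesis polar : is_polar_decomposition nu lambda nu_.

Lemma polar_measure B : measurable B -> nu B =
  lambda [set (-1)%R] * \int[nu_ (-1)]_(r in `]0%R, +oo[) (\1_B (r * -1)%R)%:E +
  lambda [set 1%R] * \int[nu_ 1]_(r in `]0%R, +oo[) (\1_B (r * 1)%R)%:E.
Proof.
move=> mB; have [_ _ _ ->//] := polar.
rewrite ge0_integral_pm1 => [|x]; first by rewrite muleC [X in _ + X]muleC.
by apply: integral_ge0 => r _; rewrite lee_fin.
Qed.

(** A set inside one open half-line never meets the opposite ray, so one of the two terms
    vanishes. *)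
Lemma polar_side (xi : R) B : [set (-1)%R; 1%R] xi -> measurable B ->
  B `<=` [set x | (0 < x * xi)%R] ->
  nu B = lambda [set xi] * \int[nu_ xi]_(r in `]0%R, +oo[) (\1_B (r * xi)%R)%:E.
Proof.
move=> xi1 mB Bxi; rewrite polar_measure//.
have side0 (eta : R) (m : {measure set RB -> \bar R}) : (eta * xi < 0)%R ->
    \int[m]_(r in `]0%R, +oo[) (\1_B (r * eta)%R)%:E = 0.
  move=> eta0; rewrite (@eq_integral _ _ _ _ _ (cst 0)) ?integral0// => r.
  rewrite inE /= in_itv/= andbT => r0; rewrite indicE memNset//.
  by move/Bxi => /=; rewrite -mulrA pmulr_rgt0// ltNge (ltW eta0).
case: xi1 => xi1; rewrite xi1 in side0 *.
- by rewrite (side0 1%R) ?mule0 ?adde0// mul1r oppr_lt0.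
- by rewrite (side0 (-1)%R) ?mule0 ?add0e// mulr1 oppr_lt0.
Qed.

(** If [lambda {xi}] were infinite, the finiteness of [nu (B n)] would force [nu_ xi (A n) = 0] for
    every [n]; since the [A n] exhaust the half-line, [nu_ xi] would vanish there, against its
    positivity. *)
Lemma polar_spherical_finite (xi : R) : [set (-1)%R; 1%R] xi ->
  lambda [set xi] \is a fin_num.
Proof.
move=> xi1; rewrite ge0_fin_numE//; rewrite ltey; apply/negP => /eqP ly.
have [_ _ /(_ _ xi1)[_ pos] _] := polar.
pose B n : set RB := [set x | (n.+1%:R^-1 <= Num.min 1 (x ^+ 2))%R].
have mB n : measurable (B n).
  have -> : B n = (fun x : R => Num.min 1 (x ^+ 2))%R @^-1`
      `[(n.+1%:R^-1)%R, +oo[%classic.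
    by apply/seteqP; split=> x /=; rewrite in_itv/= andbT.
  by rewrite -[X in measurable X]setTI; exact: measurable_min1_sqr.
pose A n : set RB := `]0%R, +oo[%classic `&` B n.
have mA n : measurable (A n) by exact: measurableI.
have A0 n : nu_ xi (A n) = 0.
  have : lambda [set xi] * nu_ xi (A n) <= nu (B n).
    (* [B n] depends only on [x ^ 2], so multiplication by [xi] preserves it. *)
    have sqr1 (r : R) : \1_(B n) (r * xi)%R = \1_(B n) r :> R.
      rewrite !indicE; congr (_%:R); congr nat_of_bool.
      apply/idP/idP; rewrite !inE /B/= exprMn;
        by case: xi1 => ->; rewrite ?sqrrN expr1n mulr1.
    have int1 : \int[nu_ xi]_(r in `]0%R, +oo[) (\1_(B n) (r * xi)%R)%:E =
        nu_ xi (A n).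
      under eq_integral => r _ do rewrite sqr1.
      by rewrite integral_indic// setIC.
    rewrite polar_measure// -int1.
    have g0 (eta : R) : 0 <= lambda [set eta] *
        \int[nu_ eta]_(r in `]0%R, +oo[) (\1_(B n) (r * eta)%R)%:E.
      by apply: mule_ge0 => //; apply: integral_ge0 => r _; rewrite lee_fin.
    by case: xi1 => ->; [rewrite leeDl|rewrite leeDr].
  have Bfin : nu (B n) < +oo by exact: levy_tail_finite.
  rewrite ly => /le_lt_trans/(_ Bfin).
  have : 0 <= nu_ xi (A n) by [].
  rewrite le_eqVlt => /predU1P[<-//|Apos].
  by rewrite gt0_mulye// ltxx.
suff : nu_ xi `]0%R, +oo[%classic = 0 by move=> z; rewrite z ltxx in pos.
have -> : `]0%R, +oo[%classic = \bigcup_n A n.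
  apply/seteqP; split=> [x x0|x [n _ []]//].
  have m0 : (0 < Num.min 1 (x ^+ 2))%R.
    move: x0; rewrite /= in_itv/= andbT => x0.
    by rewrite lt_min ltr01 exprn_gt0.
  have [n] := ltr_add_invr m0; rewrite add0r => /ltW h.
  by exists n.
apply/eqP; rewrite -measure_le0.
have := @measure_sigma_subadditive _ _ _ (nu_ xi) (\bigcup_n A n) A mA
  (bigcup_measurable (fun n _ => mA n)) (@subset_refl _ _).
by rewrite eseries0// => n _ _; rewrite A0.
Qed.

End polar_decomposition.

(** * Sections of a Borel set along rays *)

Section rays.
Context {R : realType} (n : nat).
Local Notation RB := (measurableTypeR R).
Local Notation MB := 'M[R[i]]_n.
Implicit Types (xi : R) (B : set MB) (W : MB).

(** The condition [0 < x * xi] selects the jumps [x] of sign [xi], and [x * xi] is then [|x|].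
    Presenting [ray] as a section of a measurable set of pairs gives the measurability of its
    [nu]-mass in [W], [nu] being sigma-finite. *)
Definition ray_graph xi B : set (MB * RB) :=
  [set Wx | 0 < Wx.2 * xi /\ B ((Wx.2 * xi)%:C *: Wx.1)].

Definition ray xi B W : set RB := xsection (ray_graph xi B) W.

Lemma scaleNN (x : R) W : (- x)%:C *: - W = x%:C *: W.
Proof. by rewrite (rmorphN (real_complex R)) scaleNr scalerN opprK. Qed.

Lemma rayE xi B W : ray xi B W = [set x | 0 < x * xi /\ B ((x * xi)%:C *: W)].
Proof. by apply/seteqP; split=> x; rewrite /ray /xsection /= inE. Qed.

Lemma measurable_ray_graph xi B : measurable B -> measurable (ray_graph xi B).
Proof.
move=> mB.
have m2 : measurable_fun setT (fun Wx : MB * RB => Wx.2 * xi).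
  by apply: measurable_funM.
have mW : measurable_fun setT (fun Wx : MB * RB => (Wx.2 * xi)%:C *: Wx.1 : MB).
  apply: measurable_fun_mx => i j.
    under eq_fun do rewrite mxE Re_mulRc.
    apply: measurable_funM => //.
    exact: (measurableT_comp (measurable_Re_entry i j) measurable_fst).
  under eq_fun do rewrite mxE Im_mulRc.
  apply: measurable_funM => //.
  exact: (measurableT_comp (measurable_Im_entry i j) measurable_fst).
have -> : ray_graph xi B =
    (fun Wx : MB * RB => Wx.2 * xi) @^-1` `]0, +oo[%classic `&`
    (fun Wx : MB * RB => (Wx.2 * xi)%:C *: Wx.1 : MB) @^-1` B.
  by apply/seteqP; split=> Wx /=; rewrite in_itv/= andbT.
by apply: measurableI; rewrite -[X in measurable X]setTI; [exact: m2|exact: mW].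
Qed.

Lemma measurable_ray xi B W : measurable B -> measurable (ray xi B W).
Proof. by move=> mB; apply: measurable_xsection; exact: measurable_ray_graph. Qed.

Lemma polar_ray (nu lambda : {measure set RB -> \bar R})
    (nu_ : R -> {measure set RB -> \bar R}) xi B W :
  is_polar_decomposition nu lambda nu_ -> [set -1; 1] xi -> measurable B ->
  nu (ray xi B W) =
  (lambda [set xi] * \int[nu_ xi]_(r in `]0%R, +oo[) (\1_B (r%:C *: W))%:E)%E.
Proof.
move=> polar xi1 mB; rewrite (polar_side polar xi1).
- congr (_ * _)%E; apply: eq_integral => r; rewrite inE/= in_itv/= andbT => r0.
  have rxi : r * xi * xi = r by case: xi1 => ->; rewrite -mulrA ?mulrNN ?mulr1.
  congr (_%:E); rewrite !indicE; congr (_%:R); congr nat_of_bool.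
  by apply/idP/idP; rewrite !inE rayE /= rxi => // -[].
- exact: measurable_ray.
- by rewrite rayE => x [].
Qed.

Variable nu : {sigma_finite_measure set RB -> \bar R}.

Lemma measurable_fun_ray xi B : measurable B ->
  measurable_fun [set: MB] (fun W : MB => nu (ray xi B W)).
Proof.
by move=> mB; exact: (measurable_fun_xsection nu (measurable_ray_graph xi mB)).
Qed.

Context d (T : measurableType d).
Variables (P : probability T R) (V : T -> MB).
Hypothesis mV : measurable_fun setT V.

(** A negative jump [x] along [V] is the positive jump [|x|] along [- V], and [x = 0] contributes
    nothing since [B] omits 0. *)
Lemma levy_mx_ray B : measurable B -> ~ B 0 ->
  levy_mx P nu mV B =
  (n%:R%:E * \int[P]_w (nu (ray 1 B (V w)) + nu (ray (-1) B (- V w))))%E.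
Proof.
move=> mB B0; rewrite levy_mxE; congr (_ * _)%E.
apply: eq_integral => w _ /=; rewrite -measureU; last 3 first.
- exact: measurable_ray.
- exact: measurable_ray.
- apply/seteqP; split=> x //=; rewrite !rayE /= => -[[+ _] [+ _]].
  by rewrite mulr1 mulrN1 oppr_gt0 => /lt_trans/[apply]; rewrite ltxx.
congr (nu _); apply/seteqP; split=> x.
  rewrite /xsection /= inE /scaled_projector /= => Bx.
  have [x0|x0|x0] := ltgtP x 0.
  - right; rewrite rayE /= mulrN1 oppr_gt0; split => //.
    by rewrite scaleNN.
  - by left; rewrite rayE /= mulr1.
  - by exfalso; apply: B0; move: Bx; rewrite x0 scale0r.
rewrite /xsection /= inE /scaled_projector /= !rayE /= => -[[_]|[_]].
  by rewrite mulr1.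
by rewrite mulrN1 scaleNN.
Qed.

End rays.

(** * Borel measurability of the set of rank one projectors *)

Section spherical_component.
Context {R : realType} (n : nat).
Local Notation RB := (measurableTypeR R).
Local Notation MB := 'M[R[i]]_n.
Local Open Scope ereal_scope.

Lemma measurable_rank1_projector : measurable (@rank1_projector R n).
Proof.
have mRe i j := @measurable_Re_entry R n i j.
have mIm i j := @measurable_Im_entry R n i j.
have meq0 (f : MB -> R) : measurable_fun setT f -> measurable [set W | f W = 0%R].
  move=> mf; rewrite -[X in measurable X]setTI.
  exact: (mf measurableT [set 0%R] (measurable_set1 _)).
(* Real and imaginary parts of the defining equations give finitely many zero sets of measurable
   functions. The trace is written [\tr (W *m 1%:M)] to match [measurable_Re_mxtraceM] and its
   imaginary counterpart. *)
have -> : @rank1_projector R n =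
  (\bigcap_(ij in [set: 'I_n * 'I_n])
     ([set W : MB | complex.Re (W ij.1 ij.2) - complex.Re (W ij.2 ij.1) = 0%R]%R `&`
      [set W : MB | complex.Im (W ij.1 ij.2) + complex.Im (W ij.2 ij.1) = 0%R]%R)) `&`
  (\bigcap_(p in [set: ('I_n * 'I_n) * ('I_n * 'I_n)])
     ([set W : MB | complex.Re (W p.1.1 p.1.2 * W p.2.1 p.2.2 -
                                W p.1.1 p.2.2 * W p.2.1 p.1.2) = 0%R]%R `&`
      [set W : MB | complex.Im (W p.1.1 p.1.2 * W p.2.1 p.2.2 -
                                W p.1.1 p.2.2 * W p.2.1 p.1.2) = 0%R]%R)) `&`
  ([set W : MB | complex.Re (\tr (W *m 1%:M)) - 1 = 0%R]%R `&`
   [set W : MB | complex.Im (\tr (W *m 1%:M)) = 0%R]%R).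
  apply/seteqP; split=> W.
    move=> [/hermP hW mW tW]; split; [split|].
    - by move=> [i j] _ /=; rewrite (hW i j); case: (W j i) => a b /=;
        rewrite subrr addNr.
    - by move=> [[i j] [k l]] _ /=; rewrite (mW i j k l) subrr.
    - by rewrite /= mulmx1 tW /= subrr.
  move=> [[hW mW] [tRe tIm]]; split.
  - apply/hermP => i j; have [/=] := hW (i, j) I.
    move=> /eqP; rewrite subr_eq0 => /eqP h1 /eqP; rewrite addr_eq0 => /eqP h2.
    by apply/eqP; rewrite eq_complex h1 h2; case: (W j i) => a b /=; rewrite !eqxx.
  - move=> i j k l; have [/= h1 h2] := mW ((i, j), (k, l)) I.
    apply/eqP; rewrite -subr_eq0; apply/eqP; move: h1 h2.
    by case: (_ - _)%R => a b /= -> ->.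
  - move: tRe tIm; rewrite /= mulmx1; case: (\tr W) => a b /= /eqP.
    by rewrite subr_eq0 => /eqP -> ->.
have mRM (i j k l : 'I_n) : measurable_fun [set: MB]
    (fun W : MB => complex.Re (W i j * W k l)%R).
  have -> : (fun W : MB => complex.Re (W i j * W k l)%R) = (fun W : MB =>
      complex.Re (W i j) * complex.Re (W k l) - complex.Im (W i j) * complex.Im (W k l))%R.
    by apply/funext => W; case: (W i j) (W k l) => ? ? [].
  by apply: measurable_funB; apply: measurable_funM; (exact: mRe || exact: mIm).
have mIM (i j k l : 'I_n) : measurable_fun [set: MB]
    (fun W : MB => complex.Im (W i j * W k l)%R).
  have -> : (fun W : MB => complex.Im (W i j * W k l)%R) = (fun W : MB =>
      complex.Re (W i j) * complex.Im (W k l) + complex.Im (W i j) * complex.Re (W k l))%R.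
    by apply/funext => W; case: (W i j) (W k l) => ? ? [].
  by apply: measurable_funD; apply: measurable_funM; (exact: mRe || exact: mIm).
apply: measurableI; [apply: measurableI|].
- apply: fin_bigcap_measurable => [|[i j] _]; first exact: finite_finset.
  by apply: measurableI; apply: meq0; [apply: measurable_funB|apply: measurable_funD].
- apply: fin_bigcap_measurable => [|[[i j] [k l]] _]; first exact: finite_finset.
  apply: measurableI; apply: meq0.
    under eq_fun do rewrite raddfB.
    exact: measurable_funB (mRM i j k l) (mRM i l k j).
  under eq_fun do rewrite raddfB.
  exact: measurable_funB (mIM i j k l) (mIM i l k j).
- apply: measurableI; apply: meq0.
    by apply: measurable_funB => //; exact: measurable_Re_mxtraceM.
  exact: measurable_Im_mxtraceM.
Qed.

Lemma measurable_oppmx : measurable_fun [set: MB] (fun W : MB => - W)%R.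
Proof.
apply: measurable_fun_mx => i j.
  under eq_fun do rewrite mxE raddfN.
  exact: measurable_funN (measurable_Re_entry i j).
under eq_fun do rewrite mxE raddfN.
exact: measurable_funN (measurable_Im_entry i j).
Qed.

End spherical_component.

(** * The spherical measure and its polar integrals *)

Section spherical_measure.
Context {R : realType} (n : nat) d (T : measurableType d).
Local Notation RB := (measurableTypeR R).
Local Notation MB := 'M[R[i]]_n.
Local Open Scope ereal_scope.
Variables (P : probability T R) (V : T -> MB).
Hypothesis mV : measurable_fun setT V.
Hypothesis pV : forall w, rank1_projector (V w).
Variables (nu : {sigma_finite_measure set RB -> \bar R})
  (lambda : {measure set RB -> \bar R}) (nu_ : R -> {measure set RB -> \bar R}).
Hypothesis nuy : \int[nu]_x (Num.min 1 (x ^+ 2))%:E < +oo.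
Hypothesis polar : is_polar_decomposition nu lambda nu_.

Lemma measurable_opp_projector : measurable_fun setT (fun w => - V w)%R.
Proof. exact: (measurableT_comp (@measurable_oppmx R n) mV). Qed.

(** [fine] would send an infinite mass to 0; [polar_spherical_finite] rules this out, which is the
    content of [lambdaE]. *)
Definition spherical_mass (xi : R) : {nonneg R} :=
  NngNum (fine_ge0 (measure_ge0 lambda [set xi])).

Definition spherical_mx : {measure set MB -> \bar R} :=
  measure_add (mscale (spherical_mass 1) (push_measure P mV))
              (mscale (spherical_mass (-1)) (push_measure P measurable_opp_projector)).

Let lambdaE xi : [set (-1)%R; 1%R] xi ->
  lambda [set xi] = ((spherical_mass xi)%:num)%:E.
Proof. by move=> xi1; rewrite /= fineK//; exact: (polar_spherical_finite nuy polar). Qed.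

Lemma spherical_mxE A : spherical_mx A =
  ((spherical_mass 1)%:num)%:E * P (V @^-1` A) +
  ((spherical_mass (-1))%:num)%:E * P ((fun w => - V w)%R @^-1` A).
Proof. exact: measure_addE. Qed.

Lemma spherical_mx_support : spherical_mx (~` rank1_sphere n) = 0.
Proof.
rewrite spherical_mxE.
have -> : V @^-1` (~` rank1_sphere n) = set0.
  apply/seteqP; split=> w //=; apply; exact: rank1_projector_sphere.
have -> : (fun w => - V w)%R @^-1` (~` rank1_sphere n) = set0.
  apply/seteqP; split=> w //=; apply.
  by apply/rank1_sphereN; exact: rank1_projector_sphere.
by rewrite measure0 !mule0 adde0.
Qed.

Lemma ge0_integral_spherical_mx (g : MB -> \bar R) :
  measurable_fun setT g -> (forall W, 0 <= g W) ->
  \int[spherical_mx]_W g W =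
  ((spherical_mass 1)%:num)%:E * \int[P]_w g (V w) +
  ((spherical_mass (-1))%:num)%:E * \int[P]_w g (- V w)%R.
Proof.
move=> mg g0; rewrite ge0_integral_measure_add//.
rewrite !ge0_integral_mscale//.
rewrite (ge0_integral_pushforward mV)//.
by rewrite (ge0_integral_pushforward measurable_opp_projector).
Qed.

Let Sp := @rank1_projector R n.
Let Sm := [set W : MB | rank1_projector (- W)%R].

Let mSp : measurable Sp. Proof. exact: measurable_rank1_projector. Qed.

Let mSm : measurable Sm.
Proof.
have -> : Sm = (fun W : MB => - W)%R @^-1` Sp by [].
by rewrite -[X in measurable X]setTI; exact: measurable_oppmx.
Qed.

Let SpN w : Sp (V w). Proof. exact: pV. Qed.
Let SmN w : Sm (- V w)%R. Proof. by rewrite /Sm /= opprK. Qed.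
Let SpSm W : Sp W -> ~ Sm W. Proof. exact: rank1_projector_Nprojector. Qed.

Lemma spherical_mx_integral (D : set MB) : measurable D -> D `<=` rank1_sphere n ->
  \int[spherical_mx]_(W in rank1_sphere n) (\1_D W)%:E =
  \int[push_measure P mV]_(W in rank1_sphere_pos n)
    \int[lambda]_(xi in [set (-1)%R; 1%R]) (\1_D (xi%:C *: W)%R)%:E.
Proof.
move=> mD DS; rewrite [LHS]integral_mkcond.
have -> : (fun W : MB => (\1_D W : R)%:E) \_ (@rank1_sphere R n) =
    (fun W : MB => (\1_D W : R)%:E).
  apply/funext => W; rewrite patchE; case: ifPn => // WS.
  by rewrite indicE memNset// => /DS DW; rewrite notin_setE in WS.
rewrite integral_indic// setIT spherical_mxE rank1_sphere_posE.
(* The inner integral over [{-1, 1}] in closed form, with evident measurability in [W]. *)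
pose g (W : MB) : \bar R := ((spherical_mass 1)%:num)%:E * (\1_D W)%:E +
    ((spherical_mass (-1))%:num)%:E * (\1_((fun W : MB => - W)%R @^-1` D) W)%:E.
have mND : measurable ((fun W : MB => - W)%R @^-1` D).
  by rewrite -[X in measurable X]setTI; exact: measurable_oppmx.
have mg1 : measurable_fun [set: MB] (fun W : MB => (\1_D W : R)%:E).
  exact/measurable_EFinP/measurable_indic.
have mg2 : measurable_fun [set: MB]
    (fun W : MB => (\1_((fun W : MB => - W)%R @^-1` D) W : R)%:E).
  exact/measurable_EFinP/measurable_indic.
have g0 W : 0 <= g W by rewrite adde_ge0// mule_ge0// lee_fin.
have mg : measurable_fun setT g.
  by apply: emeasurable_funD; exact: measurable_funeM.
transitivity (\int[push_measure P mV]_(W in Sp) g W); last first.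
  apply: eq_integral => W _; rewrite ge0_integral_pm1; last by move=> x; rewrite lee_fin.
  rewrite !lambdaE; [|by right|by left].
  rewrite addeC muleC [X in _ + X]muleC /g; congr (_ * _ + _ * _).
    by rewrite scale1r.
  by rewrite (rmorphN (real_complex R)) rmorph1 scaleN1r.
rewrite (ge0_integral_pushforward mV)//; last exact: measurable_funTS.
have -> : V @^-1` Sp = setT by apply/seteqP; split=> // w _; exact: SpN.
have mgV (f : MB -> \bar R) : measurable_fun setT f -> measurable_fun setT (f \o V).
  by move=> mf; exact: measurableT_comp.
rewrite /g /= ge0_integralD//; last 2 first.
- by apply: measurable_funeM; exact: mgV mg1.
- by apply: measurable_funeM; exact: mgV mg2.
rewrite !ge0_integralZl_EFin//; last 2 first.
- exact: mgV mg2.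
- exact: mgV mg1.
have mpre (f : T -> MB) E : measurable_fun setT f -> measurable E ->
    measurable (f @^-1` E).
  by move=> mf mE; rewrite -[X in measurable X]setTI; exact: mf.
have intV E : measurable E -> \int[P]_w (\1_E (V w))%:E = P (V @^-1` E).
  move=> mE; rewrite -[in RHS](setIT (V @^-1` E)) -integral_indic//.
  exact: mpre.
by rewrite !intV.
Qed.

Lemma spherical_mx_polar (B : set MB) : measurable B -> ~ B 0%R ->
  \int[spherical_mx]_(W in rank1_sphere n)
    \int[radial_component nu_ W]_(r in `]0%R, +oo[) (\1_B (r%:C *: W)%R)%:E =
  \int[P]_w (nu (ray 1 B (V w)) + nu (ray (-1) B (- V w)%R)).
Proof.
move=> mB B0.
have c1 : [set (-1)%R; 1%R] 1%R :> Prop by right.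
have cm1 : [set (-1)%R; 1%R] (-1)%R :> Prop by left.
pose l1 := (spherical_mass 1)%:num; pose lm1 := (spherical_mass (-1))%:num.
have l1_ge0 : (0 <= l1)%R by exact: fine_ge0.
have lm1_ge0 : (0 <= lm1)%R by exact: fine_ge0.
pose h (W : MB) := \int[radial_component nu_ W]_(r in `]0%R, +oo[) (\1_B (r%:C *: W)%R)%:E.
have h0 W : 0 <= h W by apply: integral_ge0 => r _; rewrite lee_fin.
(* A measurable substitute for [h]: on each component the radial integral is recovered as
   [nu (ray xi B W)] divided by [lambda {xi}]. For a zero mass the convention [0^-1 = 0] kills the
   term. *)
pose g (W : MB) := (l1^-1 * \1_Sp W)%:E * nu (ray 1 B W) +
                   (lm1^-1 * \1_Sm W)%:E * nu (ray (-1) B W).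
have g0 W : 0 <= g W.
  by apply: adde_ge0; apply: mule_ge0 => //; rewrite lee_fin mulr_ge0// invr_ge0.
have mg : measurable_fun setT g.
  apply: emeasurable_funD; apply: emeasurable_funM.
  - by apply/measurable_EFinP; apply: measurable_funM => //; exact: measurable_indic.
  - exact: measurable_fun_ray.
  - by apply/measurable_EFinP; apply: measurable_funM => //; exact: measurable_indic.
  - exact: measurable_fun_ray.
have rayE1 W : nu (ray 1 B W) = l1%:E *
    \int[nu_ 1%R]_(r in `]0%R, +oo[) (\1_B (r%:C *: W)%R)%:E.
  by rewrite (polar_ray _ polar)// lambdaE.
have rayEm1 W : nu (ray (-1) B W) = lm1%:E *
    \int[nu_ (-1)%R]_(r in `]0%R, +oo[) (\1_B (r%:C *: W)%R)%:E.
  by rewrite (polar_ray _ polar)// lambdaE.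
(* Off E the two integrands may differ and the left one may fail to be
   measurable: if lambda {xi} = 0 then nu_ xi is arbitrary. *)
pose E := (if l1 == 0%R then set0 else Sp) `|` (if lm1 == 0%R then set0 else Sm).
have mE : measurable E by apply: measurableU; case: ifP.
have E0 : spherical_mx (~` E) = 0.
  rewrite spherical_mxE -/l1 -/lm1.
  have -> : l1%:E * P (V @^-1` (~` E)) = 0.
    have [->|l10] := eqVneq l1 0%R; first by rewrite mul0e.
    rewrite (_ : _ @^-1` _ = set0) ?measure0 ?mule0//.
    by apply/seteqP; split=> w //=; apply; left; rewrite (negbTE l10); exact: SpN.
  rewrite add0e; have [->|l10] := eqVneq lm1 0%R; first by rewrite mul0e.
  rewrite (_ : _ @^-1` _ = set0) ?measure0 ?mule0//.
  by apply/seteqP; split=> w //=; apply; right; rewrite (negbTE l10); exact: SmN.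
rewrite [LHS]integral_mkcond -/h.
rewrite (@ge0_eq_integral_conegligible _ _ _ _ E _ g mE E0)//; last 2 first.
- by move=> W; apply: erestrict_ge0 => W' _; exact: h0.
- move=> W /set_mem EW.
  have SW : W \in rank1_sphere n.
    rewrite inE; apply/rank1_sphereE; move: EW; rewrite /E.
    by case: ifP => _; case: ifP => _ [//|//]; [right|left|left|right].
  rewrite patchE SW /h /g /radial_component.
  have mulK (l : R) x : l != 0%R -> (l^-1)%:E * (l%:E * x) = x.
    by move=> l0; rewrite muleA -EFinM mulVf// mul1e.
  move: EW => [].
    case: eqVneq => // l10 pW; rewrite asboolT; last exact: rank1_projector_psd.
    rewrite !indicE (mem_set pW) mulr1 memNset; last exact: SpSm.
    by rewrite mulr0 mul0e adde0 rayE1 mulK.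
  case: eqVneq => // l10 pW; rewrite asboolF; last exact: rank1_projectorN_psd.
  rewrite !indicE (mem_set pW) mulr1 memNset; last by move/SpSm; apply.
  by rewrite mulr0 mul0e add0e rayEm1 mulK.
rewrite ge0_integral_spherical_mx// -/l1 -/lm1.
have mray xi (f : T -> MB) : measurable_fun setT f ->
    measurable_fun setT (fun w => nu (ray xi B (f w))).
  by move=> mf; exact: (measurableT_comp (measurable_fun_ray nu xi mB) mf).
rewrite [RHS]ge0_integralD//; last 2 first.
- exact: mray.
- exact: mray measurable_opp_projector.
congr (_ + _).
- rewrite -ge0_integralZl_EFin//; last by apply: measurableT_comp.
  apply: eq_integral => w _; rewrite /g !indicE (mem_set (SpN w)) mulr1.
  rewrite memNset; last exact: SpSm.
  (* For a zero mass both sides vanish, by the polar formula for [nu (ray 1 B _)]; otherwise the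
     mass cancels its inverse. *)
  rewrite mulr0 mul0e adde0 rayE1; have [->|l10] := eqVneq l1 0%R.
    by rewrite !mul0e.
  by rewrite muleA -EFinM mulfV// mul1e.
- rewrite -ge0_integralZl_EFin//; last exact: (measurableT_comp mg measurable_opp_projector).
  apply: eq_integral => w _; rewrite /g !indicE (mem_set (SmN w)) mulr1.
  rewrite memNset; last by move/SpSm; apply; exact: SmN.
  rewrite mulr0 mul0e add0e rayEm1; have [->|l10] := eqVneq lm1 0%R.
    by rewrite !mul0e.
  by rewrite muleA -EFinM mulfV// mul1e.
Qed.

End spherical_measure.

Section sigma_finite_packing.
Context d (T : measurableType d) (R : realType).
Variable nu : {measure set T -> \bar R}.
Hypothesis nu_sigma_finite : sigma_finite setT nu.

(** A separate name for [nu], to which the sigma-finite structure can be attached from the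
    hypothesis. *)
Definition sigma_finite_copy : set T -> \bar R := nu.

HB.instance Definition _ := Measure.copy sigma_finite_copy nu.
HB.instance Definition _ :=
  Measure_isSigmaFinite.Build _ _ _ sigma_finite_copy nu_sigma_finite.

End sigma_finite_packing.

(** The result remains convertible to [nu], so facts about [nu] can be passed where facts about this
    measure are expected. *)
Definition sigma_finite_measure_of d (T : measurableType d) (R : realType)
    (nu : {measure set T -> \bar R}) :
  sigma_finite setT nu -> {sigma_finite_measure set T -> \bar R}.
Proof.
pose m : {sigma_finite_measure set T -> \bar R} := sigma_finite_copy nu.
exact m.
Defined.

(** * Uniform unit vectors *)

Section unit_vector.
Context d (T : measurableType d) (R : realType) (n : nat).
Variables (P : probability T R) (u : {RV P >-> 'cV[R[i]]_n}) (i0 : 'I_n).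
Hypothesis u_sphere : uniform_on_sphere u.

Lemma sqnormCE (x : 'cV[R[i]]_n) : sqnormC x =
  \sum_i ((complex.Re (x i 0)) ^+ 2 + (complex.Im (x i 0)) ^+ 2).
Proof.
rewrite /sqnormC mxE raddf_sum; apply: eq_bigr => i _.
by rewrite !mxE; case: (x i 0) => a b /=; rewrite mulNr opprK !expr2.
Qed.

Let mu0 : measurable_fun setT u. Proof. exact: measurable_funPT. Qed.

Let mRe i : measurable_fun setT (fun w => complex.Re (u w i 0)).
Proof. exact: (measurable_fun_coord i 0 mu0 continuous_Re). Qed.

Let mIm i : measurable_fun setT (fun w => complex.Im (u w i 0)).
Proof. exact: (measurable_fun_coord i 0 mu0 continuous_Im). Qed.

Lemma measurable_sqnormC : measurable_fun setT (fun w => sqnormC (u w)).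
Proof.
under eq_fun do rewrite sqnormCE.
apply: measurable_sum => i.
by apply: measurable_funD; apply: measurable_funX; (exact: mRe || exact: mIm).
Qed.

Lemma measurable_outer : measurable_fun setT (fun w => u w *m (u w)^t*).
Proof.
apply: measurable_fun_mx => i j.
  have -> : (fun w => complex.Re ((u w *m (u w)^t*) i j)) =
    (fun w => complex.Re (u w i 0) * complex.Re (u w j 0) +
              complex.Im (u w i 0) * complex.Im (u w j 0)).
    apply/funext => w; rewrite !mxE big_ord1 !mxE.
    by case: (u w i 0) (u w j 0) => a b [c e] /=; rewrite mulrN opprK.
  by apply: measurable_funD; apply: measurable_funM; (exact: mRe || exact: mIm).
have -> : (fun w => complex.Im ((u w *m (u w)^t*) i j)) =
  (fun w => complex.Im (u w i 0) * complex.Re (u w j 0) -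
            complex.Re (u w i 0) * complex.Im (u w j 0)).
  apply/funext => w; rewrite !mxE big_ord1 !mxE.
  by case: (u w i 0) (u w j 0) => a b [c e] /=; rewrite mulrN addrC.
by apply: measurable_funB; apply: measurable_funM; (exact: mRe || exact: mIm).
Qed.

Definition unit_event : set T := [set w | sqnormC (u w) = 1].

Lemma measurable_unit_event : measurable unit_event.
Proof.
have -> : unit_event = (fun w => sqnormC (u w)) @^-1` [set 1] by [].
by rewrite -[X in measurable X]setTI; exact: measurable_sqnormC.
Qed.

Lemma unit_event_conegligible : P (~` unit_event) = 0%E.
Proof.
have [u1 _] := u_sphere.
rewrite probability_setC; last exact: measurable_unit_event.
by rewrite (_ : P unit_event = 1%E)// subee.
Qed.

(* A version of u u^* which is everywhere, and not only almost surely, an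
   orthogonal projector of rank one. *)
Definition projector_version w : 'M[R[i]]_n :=
  if sqnormC (u w) == 1 then u w *m (u w)^t* else delta_mx i0 i0.

Lemma measurable_projector_version : measurable_fun setT projector_version.
Proof.
apply: measurable_fun_ifT; last exact: measurable_cst.
  by apply: measurable_fun_eqr => //; exact: measurable_sqnormC.
exact: measurable_outer.
Qed.

Lemma projector_versionP w : rank1_projector (projector_version w).
Proof.
rewrite /projector_version; case: eqP => [/rank1_projector_outer//|_].
split.
- by apply/hermP => i j; rewrite !mxE andbC conjc_nat.
- move=> i j k l; rewrite !mxE -!natrM !mulnb; congr (_%:R).
  by rewrite andbACA andbC andbACA [(_ == i0) && (j == i0)]andbC; do 4!case: eqP.
- rewrite /mxtrace (bigD1 i0)//= big1 ?addr0; first by rewrite mxE !eqxx.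
  by move=> i /negbTE ii0; rewrite mxE ii0.
Qed.

Lemma projector_versionE w : unit_event w ->
  projector_version w = u w *m (u w)^t*.
Proof. by move=> /eqP uw; rewrite /projector_version uw. Qed.

Lemma projector_version_law (A : set 'M[R[i]]_n) : measurable A ->
  omega u A = P (projector_version @^-1` A).
Proof.
move=> mA; rewrite /omega /pushforward.
have mpre (f : T -> 'M[R[i]]_n) : measurable_fun setT f -> measurable (f @^-1` A).
  by move=> mf; rewrite -[X in measurable X]setTI; exact: mf.
have intE X : measurable X -> P X = (\int[P]_w (\1_X w)%:E)%E.
  by move=> mX; rewrite integral_indic// setIT.
rewrite !intE; [|exact: mpre measurable_projector_version
                |exact: mpre measurable_outer].
apply: (ge0_eq_integral_conegligible measurable_unit_event unit_event_conegligible).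
- by move=> w; rewrite lee_fin.
- by move=> w; rewrite lee_fin.
- move=> w /set_mem Ew; rewrite !indicE; congr ((nat_of_bool _)%:R%:E).
  by apply/idP/idP; rewrite !inE /= projector_versionE.
Qed.

End unit_vector.

Theorem theorem1 (R : realType)
  (mu : probability (measurableTypeR R) R)
  (nu lambda : {measure set (measurableTypeR R) -> \bar R})
  (nu_ : R -> {measure set (measurableTypeR R) -> \bar R})
  (Cmu : R -> R[i])
  (rho : probability (measurableTypeR R) R)
  (dispM : nat -> measure_display)
  (TM : forall d : nat, measurableType (dispM d))
  (P : forall d : nat, probability (TM d) R)
  (M : forall d : nat, {RV (P d) >-> 'M[R[i]]_d})
  (dispU : nat -> measure_display)
  (TU : forall d : nat, measurableType (dispU d))
  (PU : forall d : nat, probability (TU d) R)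
  (u : forall d : nat, {RV (PU d) >-> 'cV[R[i]]_d}) :
  infinitely_divisible mu ->
  is_levy_measure mu nu ->
  (0 < nu setT)%E ->
  is_polar_decomposition nu lambda nu_ ->
  is_cumulant_transform mu Cmu ->
  bercovici_pata mu rho ->
  (forall d : nat, (0 < d)%N -> uniform_on_sphere (u d)) ->
  (forall d : nat, (0 < d)%N -> forall w, herm d (M d w)) ->
  random_matrix_model M rho ->
  (forall d : nat, (0 < d)%N -> forall A : 'M[R[i]]_d, herm d A ->
     cintegral (P d) (fun w => cexp ('i * \tr (M d w *m A))) =
     cexp (d%:R * cintegral (PU d) (fun w =>
             Cmu (complex.Re (((u d w)^t* *m A *m u d w) 0 0))))) ->
  forall d : nat, (0 < d)%N ->
  exists nuM Pi : {measure set 'M[R[i]]_d -> \bar R},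
    [/\ is_levy_measure_mx (M d) nuM,
        Pi (~` rank1_sphere d) = 0%E,
        forall D : set 'M[R[i]]_d, measurable D -> D `<=` rank1_sphere d ->
          (\int[Pi]_(V in rank1_sphere d) (\1_D V)%:E =
           \int[omega (u d)]_(V in rank1_sphere_pos d)
             \int[lambda]_(xi in [set (-1)%R; 1%R]) (\1_D (xi%:C *: V))%:E)%E &
        forall B : set 'M[R[i]]_d, measurable B -> B `<=` herm d `\ 0 ->
          nuM B =
          (d%:R%:E * \int[Pi]_(V in rank1_sphere d)
             \int[radial_component nu_ V]_(r in `]0%R, +oo[)
               (\1_B (r%:C *: V))%:E)%E].
Proof.
move=> _ [nu0 nuy [gamma [a [a0 muE]]]] _ polar cumul _ u_sphere hM _ FM d d0.
pose nus := sigma_finite_measure_of (levy_sigma_finite nu0 nuy).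
(* A positive dimension provides the index of the default projector used where [u] is not a unit
   vector. *)
pose i0 : 'I_d := Ordinal d0.
pose V := projector_version (u d) i0.
have mV : measurable_fun setT V := measurable_projector_version (u d) i0.
have pV w : rank1_projector (V w) := projector_versionP (u d) i0 w.
have CE := cumulant_transform_levy nuy cumul muE.
exists (levy_mx (PU d) nus mV), (spherical_mx (PU d) mV lambda); split.
- split.
  + exact: levy_mx_support.
  + exact: levy_mx_integrability.
  + exists (levy_drift_mx (PU d) V gamma), (levy_cov_mx (PU d) V a); split.
    * exact: levy_drift_mx_herm.
    * exact: levy_cov_mx_form.
    * move=> A hA; rewrite FM//; congr cexp.
      rewrite -(levy_exponent_mx (PU d) (nu := nus) nuy mV pV CE)//; congr (_ * _).
      (* On the almost sure event [|u| = 1], the trace [tr (V A)] is the quadratic form of [A] at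
         [u]. *)
      by rewrite /cintegral; congr (_ +i* _); congr fine;
        apply: (eq_integral_conegligible (measurable_unit_event (u d))
                 (unit_event_conegligible (u_sphere d d0))) => w /set_mem uw;
        rewrite /V projector_versionE// mxtrace_outer.
- exact: spherical_mx_support.
- move=> D mD DS; rewrite (spherical_mx_integral (PU d) mV pV (nu := nus) nuy polar)//.
  (* [omega] is a bare set function; [measurable_outer] makes it a measure, and the two laws agree
     on Borel sets. *)
  apply: (eq_measure_integral (push_measure (PU d) (measurable_outer (u d)))).
  move=> A mA _; apply/esym.
  exact: (projector_version_law i0 (u_sphere d d0) mA).
- move=> B mB Bh; have B0 : ~ B 0 by move=> /Bh[_]; apply.
  by rewrite levy_mx_ray// (spherical_mx_polar (PU d) mV pV (nu := nus) nuy polar).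
Qed.
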